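(* There is a nonempty open set of points of $AdS_2$ from which every light-like geodesic intersects the singularity $\mathcal S_2$ in the future, and there is a nonempty open set of points of $AdS_2$ which escape the singularity (i.e. from which some light-like geodesic does not meet $\mathcal S_2$ in the future).
   Context: Here $SO(p,q)$ denotes the identity component of the special orthogonal group of signature $(p,q)$. For $l\ge2$, let $G_l=SO(2,l-1)$ act on $\mathbb R^{2,l-1}$ (two positive and $l-1$ negative directions), let $H_l=SO(1,l-1)$ be the stabilizer of a vector of square norm $+1$, and $AdS_l=G_l/H_l$, $[g]=gH_l$. Data for $l=3$: let $\mathfrak g=\mathfrak{so}(2,2)$ and $\mathfrak h$ the Lie algebra of $H_3$; $\sigma$ is the involutive automorphism of $\mathfrak g$ with $+1$-eigenspace $\mathfrak h$ and $-1$-eigenspace $\mathfrak q$; $\theta$ is a Cartan involution commuting with $\sigma$, with $\pm1$-eigenspaces $\mathfrak k,\mathfrak p$; $\mathfrak a\subset\mathfrak p$ is maximal abelian with basis $J_1\in\mathfrak h$, $J_2\in\mathfrak q$, normalized so that, with $\mathfrak g_{(\alpha,\beta)}=\{X:[J_1,X]=\alpha X,[J_2,X]=\beta X\}$, the restricted roots are $(\pm1,\pm1)$; $\mathfrak n=\mathfrak g_{(1,1)}\oplus\mathfrak g_{(1,-1)}$, $\bar{\mathfrak n}=\theta\mathfrak n$, with connected subgroups $A,N,\bar N$. Choose $X_{++}\in\mathfrak g_{(1,1)}$ with $[\theta X_{++},X_{++}]=4(J_1+J_2)$ and put $q_0=\tfrac14(X_{++}-\sigma X_{++}+\theta X_{++}-\sigma\theta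 X_{++})$, $q_1=J_2$, $p_1=[q_0,q_1]$. The singularity $\mathcal S_3\subset AdS_3$ is the union of the closed orbits of $AN$ and of $A\bar N$ in $AdS_3$ (acting by $r\cdot[g]=[rg]$). Case $l=2$: $\mathfrak{so}(2,1)$ is the subalgebra spanned by $q_0,q_1=J_2,p_1$, and $G_2=SO(2,1)\subset SO(2,2)$ is the corresponding subgroup, acting trivially on one negative coordinate and with $H_2=G_2\cap H_3$ having Lie algebra $\langle p_1\rangle$; this inclusion induces $\iota:AdS_2\to AdS_3$. One defines $\mathcal S_2=\{v\in AdS_2:\iota(v)\in\mathcal S_3\}$. The future light-like directions in $AdS_2$ are (up to positive rescaling) $E=q_0\pm q_1$; the corresponding light-like geodesic from $[g]$ is $s\mapsto[ge^{sE}]$, with future part $s>0$. *)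

(* Defs.v *)
From HB Require Import structures.
#[export] Set Warnings "-notation-overridden,-notation-incompatible-prefix".
From mathcomp Require Export all_boot all_order all_algebra.
From mathcomp Require Export all_classical all_reals all_analysis.

Set Implicit Arguments.
Unset Strict Implicit.
Unset Printing Implicit Defensive.

Export Order.TTheory GRing.Theory Num.Theory.
Export numFieldNormedType.Exports.

Local Open Scope classical_set_scope.
Local Open Scope ring_scope.

Section MatrixLie.
Variables (R : realType) (n : nat).
Local Notation M := 'M[R]_n.+1.

Definition lie (X Y : M) : M := X *m Y - Y *m X.

(* [ad X Y] is [lie X Y], as an element of the space of endomorphisms. *)
Definition ad (X : M) : 'End(M) := linfun (mulmx X \- mulmxr X).

(* The Killing form of a Lie subalgebra g: the trace over g of ad X o ad Y. *)
Definition killing (g : {vspace M}) (X Y : M) : R :=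
  \sum_(i < \dim g) coord (vbasis g) i (lie X (lie Y (vbasis g)`_i)).

Definition expm (X : M) : M :=
  limn (series (fun k : nat => (k`!%:R : R)^-1 *: X ^+ k)).

Definition is_subgroup (K : set M) : Prop :=
  [/\ K `<=` [set g | g \in unitmx],
      K 1%:M,
      (forall g h, K g -> K h -> K (g *m h)) &
      (forall g, K g -> K (invmx g))].

(* The connected Lie subgroup with Lie algebra l is the one generated by the
   exponentials of the elements of l. *)
Definition connected_subgroup (l : {vspace M}) : set M :=
  smallest is_subgroup [set expm X | X in [set X | X \in l]].

Definition lie_algebra (K : set M) : set M :=
  [set X | forall t : R, K (expm (t *: X))].

Definition lie_involution (g : {vspace M}) (f : 'End(M)) : Prop :=
  [/\ {in g, forall X, f X \in g},
      {in g &, forall X Y, f (lie X Y) = lie (f X) (f Y)} &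
      {in g, forall X, f (f X) = X}].

Definition cartan_involution (g : {vspace M}) (f : 'End(M)) : Prop :=
  lie_involution g f /\ {in g, forall X, X != 0 -> 0 < - killing g X (f X)}.

Definition eigen_in (g : {vspace M}) (f : 'End(M)) (c : R) : {vspace M} :=
  (g :&: passmx.leigenspace f c)%VS.

Definition abelian_subspace (b : {vspace M}) : Prop :=
  {in b &, forall X Y, lie X Y = 0}.

Definition maximal_abelian (p a : {vspace M}) : Prop :=
  [/\ (a <= p)%VS, abelian_subspace a &
      forall b : {vspace M},
        (a <= b)%VS -> (b <= p)%VS -> abelian_subspace b -> b = a].

Definition root_space (g : {vspace M}) (J1 J2 : M) (alpha beta : R) :
    {vspace M} :=
  (g :&: passmx.leigenspace (ad J1) alpha :&: passmx.leigenspace (ad J2) beta)%VS.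

Definition restricted_root (g : {vspace M}) (J1 J2 : M) (alpha beta : R) :
    Prop :=
  (alpha, beta) <> (0, 0) /\ root_space g J1 J2 alpha beta <> 0%VS.

End MatrixLie.

(* G/H is the set of the left cosets gH, themselves sets of matrices. *)
Section HomogeneousSpace.
Variables (R : realType) (n : nat).
Local Notation M := 'M[R]_n.+1.

Definition lcoset (H : set M) (g : M) : set M := [set g *m h | h in H].

Definition quot (G H : set M) : set (set M) := [set lcoset H g | g in G].

(* Quotient topology of G/H, where G carries the topology induced from the
   space of matrices. *)
Definition quot_open (G H : set M) (U : set (set M)) : Prop :=
  U `<=` quot G H /\ open ([set g | U (lcoset H g)] : set (subspace G)).

Definition quot_closed (G H : set M) (F : set (set M)) : Prop :=
  F `<=` quot G H /\ closed ([set g | F (lcoset H g)] : set (subspace G)).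

(* r.[g] = [rg] *)
Definition act (r : M) (x : set M) : set M := [set r *m g | g in x].

Definition orbit_of (L : set M) (x : set M) : set (set M) :=
  [set act r x | r in L].

Definition closed_orbits (G H L : set M) : set (set M) :=
  [set y | exists x, [/\ quot G H x, quot_closed G H (orbit_of L x) &
                         orbit_of L x y]].

End HomogeneousSpace.

Section AntiDeSitter.
Variable R : realType.

(* Matrix of the quadratic form of R^{2,l-1}. *)
Definition eta (l : nat) : 'M[R]_l.+1 :=
  diag_mx (\row_(i < l.+1) if (i < 2)%N then 1 else -1).

Definition sqnorm (l : nat) (v : 'cV[R]_l.+1) : R := (v^T *m eta l *m v) 0 0.

Definition Ggrp (l : nat) : set 'M[R]_l.+1 :=
  connected_component
    [set g : 'M[R]_l.+1 | g^T *m eta l *m g = eta l /\ \det g = 1] 1%:M.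

Definition Hgrp (l : nat) (v : 'cV[R]_l.+1) : set 'M[R]_l.+1 :=
  [set g | @Ggrp l g /\ g *m v = v].

(* X^T eta + eta X = 0 *)
Definition so (l : nat) : {vspace 'M[R]_l.+1} :=
  lker (linfun ((mulmxr (eta l) \o trmx) \+ mulmx (eta l))).

Local Notation M := 'M[R]_3.+1.

Definition n_alg (J1 J2 : M) : {vspace M} :=
  (root_space (so 3) J1 J2 1 1 + root_space (so 3) J1 J2 1 (-1))%VS.

(* Xpp stands for X_{++}, and v is the vector stabilized by H_3. *)
Record ads3_data (v : 'cV[R]_3.+1) (sigma theta : 'End(M)) (a : {vspace M})
    (J1 J2 Xpp : M) : Prop := Ads3Data {
  v_norm : sqnorm v = 1;
  sigma_invol : lie_involution (so 3) sigma;
  sigma_fixed : [set X | X \in eigen_in (so 3) sigma 1]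
                = lie_algebra (Hgrp v);
  theta_cartan : cartan_involution (so 3) theta;
  sigma_theta : {in so 3, forall X, sigma (theta X) = theta (sigma X)};
  a_maximal : maximal_abelian (eigen_in (so 3) theta (-1)) a;
  a_basis : basis_of a [:: J1; J2];
  J1_h : J1 \in eigen_in (so 3) sigma 1;
  J2_q : J2 \in eigen_in (so 3) sigma (-1);
  roots : forall alpha beta : R,
    restricted_root (so 3) J1 J2 alpha beta
    <-> (alpha = 1 \/ alpha = -1) /\ (beta = 1 \/ beta = -1);
  Xpp_root : Xpp \in root_space (so 3) J1 J2 1 1;
  Xpp_norm : lie (theta Xpp) Xpp = 4%:R *: (J1 + J2)
}.

Section Data.
Variables (v : 'cV[R]_3.+1) (sigma theta : 'End(M)) (a : {vspace M}).
Variables (J1 J2 Xpp : M).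

Definition q0 : M :=
  (4%:R : R)^-1 *: (Xpp - sigma Xpp + theta Xpp - sigma (theta Xpp)).
Definition q1 : M := J2.
Definition p1 : M := lie q0 q1.

Definition AdS3 : set (set M) := quot (@Ggrp 3) (Hgrp v).

Definition Agrp : set M := connected_subgroup a.
Definition Ngrp : set M := connected_subgroup (n_alg J1 J2).
Definition Nbar : set M := connected_subgroup (theta @: n_alg J1 J2)%VS.

Definition S3 : set (set M) :=
  closed_orbits (@Ggrp 3) (Hgrp v) [set r *m s | r in Agrp & s in Ngrp]
  `|` closed_orbits (@Ggrp 3) (Hgrp v) [set r *m s | r in Agrp & s in Nbar].

Definition G2 : set M := connected_subgroup <<[:: q0; q1; p1]>>%VS.
Definition H2 : set M := G2 `&` Hgrp v.
Definition AdS2 : set (set M) := quot G2 H2.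

(* [iota] maps g H_2 to (g H_2) H_3 = g H_3. *)
Definition iota2 (x : set M) : set M := [set g *m h | g in x & h in Hgrp v].

Definition S2 : set (set M) := [set x | AdS2 x /\ S3 (iota2 x)].

Definition future_lightlike : set M := [set q0 + q1; q0 - q1].

Definition geodesic (g E : M) (s : R) : set M := lcoset H2 (g *m expm (s *: E)).

Definition meets_S2_in_future (g E : M) : Prop :=
  exists2 s : R, 0 < s & S2 (geodesic g E s).

(* The geodesics from a point x are indexed by the representatives g of x and
   the future light-like E; another choice of g only rescales E. *)
Definition trapped (x : set M) : Prop :=
  forall g E : M, G2 g -> lcoset H2 g = x -> future_lightlike E ->
    meets_S2_in_future g E.

Definition escapes (x : set M) : Prop :=
  exists g E : M, [/\ G2 g, lcoset H2 g = x, future_lightlike E &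
    ~ meets_S2_in_future g E].

End Data.
End AntiDeSitter.

(* Main.v *)
(** Writing B for the quadratic form and x = X_{++}/2, y = - theta X_{++}/2, the
    triples (x, y, J_1 + J_2) and (sigma x, sigma y, J_1 - J_2) span two
    commuting copies of sl_2, because (2,0), (0,2) and their opposites are not
    roots.  Since J_1, x + sigma x and y + sigma y kill v, these relations
    determine the whole action on R^{2,2}: the vectors v, s = J_2 v, e+ = x v,
    e- = y v form a basis, and with f+- = (v +- s)/2 the pairs e+-, f+- consist
    of the eigenvectors of J_1 and J_2.

    The group AN preserves the ray of e+.  Its orbits in AdS_3 off the hyperplane
    B(., e+) = 0 are the two open sides of this hyperplane, which are not closed;
    those inside are the closed sets cut out by a sign of B(., f-).  Symmetrically
    for A Nbar and e-, so the singularity is B(., e+) B(., e-) = 0, and in AdS_2 it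
    is B(., t) = 0 where t = q_0 v = e+ - e-.

    A light-like geodesic from [g] is gv + r g(t +- s), affine in r.  An element of
    the identity component preserves the orientation of the positive plane
    <v, t>; hence for |B(gv, t)| < 1 the slope B(g(t +- s), t) has the sign of
    B(gv, v), and points with |B(gv, t)| < 1 are trapped when B(gv, t) B(gv, v) < 0
    and escape when B(gv, t) B(gv, v) > 0. *)
Require Import Defs.
From mathcomp Require Import ring lra.
Set Implicit Arguments.
Unset Strict Implicit.
Unset Printing Implicit Defensive.
Local Open Scope classical_set_scope.
Local Open Scope ring_scope.

(** * The matrix exponential *)

Section MatrixTopology.
Variables (R : realType) (m n : nat).

(** A neighbourhood of a matrix contains a product of neighbourhoods of its entries, and a filter is
    stable under the finite intersection over index pairs. *)
Lemma cvg_mxP (T : Type) (F : set_system T) (FF : Filter F)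
    (f : T -> 'M[R]_(m, n)) (M : 'M[R]_(m, n)) :
  (forall i j, f x i j @[x --> F] --> M i j) -> f x @[x --> F] --> M.
Proof.
move=> fM A [B BM BA]; rewrite nbhs_filterE.
have /filterS : F [set x | forall ij : 'I_m * 'I_n, B ij.1 ij.2 (f x ij.1 ij.2)].
  apply: filter_forall => -[i j] /=; exact: (fM i j).
by apply => x Bx; apply: BA => i j; apply: (Bx (i, j)).
Qed.

Lemma continuous_mxP (T : topologicalType) (f : T -> 'M[R]_(m, n)) :
  (forall i j, continuous (fun x => f x i j)) -> continuous f.
Proof. by move=> fc x; apply: cvg_mxP => i j; apply: fc. Qed.

End MatrixTopology.

Lemma cvg_sumr (R : realType) (T : Type) (F : set_system T) (FF : Filter F)
    (I : finType) (f : I -> T -> R) (l : I -> R) :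
  (forall i, f i x @[x --> F] --> l i) ->
  \sum_i f i x @[x --> F] --> \sum_i l i.
Proof.
move=> fl; elim: (index_enum I) => [|i s IH].
  under eq_fun do rewrite big_nil.
  by rewrite big_nil; exact: cvg_cst.
under eq_fun do rewrite big_cons.
by rewrite big_cons; apply: cvgD.
Qed.

Lemma continuous_sum (R : realType) (T : topologicalType) (I : finType)
    (f : I -> T -> R) :
  (forall i, continuous (f i)) -> continuous (fun x => \sum_i f i x).
Proof. by move=> fc x; apply: cvg_sumr => i; exact: fc. Qed.

Lemma continuous_mulmx (R : realType) (T : topologicalType) m n p
    (f : T -> 'M[R]_(m, n)) (g : T -> 'M[R]_(n, p)) :
  continuous f -> continuous g -> continuous (fun x => f x *m g x).
Proof.
move=> fc gc; apply: continuous_mxP => i j.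
have -> : (fun x => (f x *m g x) i j) = (fun x => \sum_k f x i k * g x k j).
  by apply/funext => x; rewrite mxE.
apply: continuous_sum => k x; apply: cvgM.
  exact: (cvg_comp _ _ (fc x) (@coord_continuous _ _ _ i k (f x))).
exact: (cvg_comp _ _ (gc x) (@coord_continuous _ _ _ k j (g x))).
Qed.

(** Entry by entry, so that the calculus of real functions and the termwise differentiation of real
    power series apply directly. *)
Definition is_mxderive (R : realType) m n (t : R) (F : R -> 'M[R]_(m, n))
    (D : 'M[R]_(m, n)) :=
  forall i j, is_derive t 1 (fun u => F u i j) (D i j).

Section MatrixDerivative.
Variable R : realType.

Lemma is_mxderive_cst m n (t : R) (C : 'M[R]_(m, n)) :
  is_mxderive t (fun _ => C) 0.
Proof. by move=> i j; rewrite mxE; exact: is_derive_cst. Qed.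

Lemma is_mxderive_trmx m n (t : R) (F : R -> 'M[R]_(m, n)) D :
  is_mxderive t F D -> is_mxderive t (fun u => (F u)^T) D^T.
Proof. by move=> FD i j; rewrite mxE; under eq_fun do rewrite mxE; exact: FD. Qed.

Lemma is_mxderive_mul m n p (t : R) (F : R -> 'M[R]_(m, n))
    (G : R -> 'M[R]_(n, p)) D D' :
  is_mxderive t F D -> is_mxderive t G D' ->
  is_mxderive t (fun u => F u *m G u) (D *m G t + F t *m D').
Proof.
move=> FD GD i j.
have -> : (fun u => (F u *m G u) i j)
          = \sum_k ((fun u => F u i k) * (fun u => G u k j)).
  by apply/funext => u; rewrite fct_sumE mxE.
rewrite !mxE -big_split /=.
apply: is_derive_sum => k; apply: is_derive_eq.
  exact: is_deriveM (FD i k) (GD k j).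
by rewrite /GRing.scale /=; ring.
Qed.

Lemma is_mxderive0_cst m n (F : R -> 'M[R]_(m, n)) :
  (forall t, is_mxderive t F 0) -> forall s t, F s = F t.
Proof.
move=> F0 s t; apply/matrixP => i j.
apply: (@is_derive_0_is_cst R (fun u => F u i j)) => u.
by have := F0 u i j; rewrite mxE.
Qed.

Lemma is_mxderive_continuous m n (F : R -> 'M[R]_(m, n)) (D : R -> 'M[R]_(m, n)) :
  (forall t, is_mxderive t F (D t)) -> continuous F.
Proof.
move=> FD; apply: continuous_mxP => i j t.
by apply/differentiable_continuous/derivable1_diffP; have [] := FD t i j.
Qed.

End MatrixDerivative.

(** * Convergence and differentiation of the exponential series *)

Section Exponential.
Variables (R : realType) (n : nat).
Local Notation M := 'M[R]_n.+1.
Implicit Types X : M.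

Definition expm_coef X (i j : 'I_n.+1) : R ^nat :=
  fun k => (k`!%:R)^-1 * (X ^+ k) i j.

(** The sum of the absolute values of all entries dominates every absolute row sum, so each further
    factor [X] costs at most this constant. *)
Lemma normr_exprmx_le X k i j :
  `|(X ^+ k) i j| <= (\sum_i \sum_j `|X i j|) ^+ k.
Proof.
set c := \sum_i _; have c0 : 0 <= c.
  by apply: sumr_ge0 => ? _; apply: sumr_ge0.
elim: k i j => [|k IH] i j.
  by rewrite !expr0 mxE; case: eqP; rewrite ?normr1 ?normr0.
rewrite exprS mxE (le_trans (ler_norm_sum _ _ _))// exprS.
apply: (@le_trans _ _ (\sum_l `|X i l| * c ^+ k)).
  by apply: ler_sum => l _; rewrite normrM ler_wpM2l.
rewrite -mulr_suml ler_wpM2r ?exprn_ge0// /c.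
by rewrite [leRHS](bigD1 i)//= lerDl sumr_ge0// => ? _; apply: sumr_ge0.
Qed.

(** Comparison with the scalar exponential series at c|x|, where c bounds the entries of powers as
    above. *)
Lemma is_cvg_expm_coef X i j (x : R) : cvgn (pseries (expm_coef X i j) x).
Proof.
set c := \sum_i \sum_j `|X i j|; have c0 : 0 <= c.
  by apply: sumr_ge0 => ? _; apply: sumr_ge0.
apply: normed_cvg; apply: (@series_le_cvg _ _ (exp_coeff (c * `|x|))) => //.
- by move=> k /=; exact: normr_ge0.
- by move=> k; rewrite exp_coeff_ge0 ?mulr_ge0.
- move=> k /=; rewrite /expm_coef /exp_coeff/= !normrM normrX.
  rewrite ger0_norm ?invr_ge0// -mulrA mulrC exprMn ler_wpM2r ?invr_ge0//.
  by rewrite ler_wpM2r ?exprn_ge0//; exact: normr_exprmx_le.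
- exact: is_cvg_series_exp_coeff.
Qed.

Lemma expm_seriesE X (t : R) i j k :
  series (fun k : nat => (k`!%:R : R)^-1 *: (t *: X) ^+ k) k i j
  = pseries (expm_coef X i j) t k.
Proof.
rewrite /series /pseries /series /= summxE; apply: eq_bigr => l _.
by rewrite mxE exprZn mxE /expm_coef; ring.
Qed.

Lemma cvg_expm X (t : R) :
  series (fun k : nat => (k`!%:R : R)^-1 *: (t *: X) ^+ k) @ \oo
  --> (\matrix_(i, j) limn (pseries (expm_coef X i j) t) : M).
Proof.
apply: cvg_mxP => i j; rewrite mxE.
under eq_fun do rewrite expm_seriesE.
exact: is_cvg_expm_coef.
Qed.

Lemma expmE X (t : R) i j :
  expm (t *: X) i j = limn (pseries (expm_coef X i j) t).
Proof.
by rewrite /expm (cvg_lim _ (@cvg_expm X t)) ?mxE//; exact: norm_hausdorff.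
Qed.

(** Formally, the derivative of exp(tX) is X exp(tX): the factor k+1 cancels against the factorial
    and one [X] splits off on the left. *)
Lemma pseries_diffs_expm X i j :
  pseries_diffs (expm_coef X i j) = fun k => \sum_l X i l * expm_coef X l j k.
Proof.
apply/funext => k; rewrite /pseries_diffs /expm_coef exprS mxE.
rewrite factS natrM invfM mulrA mulrA mulfV ?pnatr_eq0// mul1r mulr_sumr.
by apply: eq_bigr => l _; rewrite mulrCA.
Qed.

Lemma pseries_sumE (I : finType) (a : I -> R) (f : I -> R ^nat) (x : R) :
  pseries (fun k => \sum_l a l * f l k) x
  = (fun k => \sum_l a l * pseries (f l) x k).
Proof.
apply/funext => k; rewrite /pseries /series /=.
under eq_bigr do rewrite mulr_suml.
rewrite exchange_big /=; apply: eq_bigr => l _; rewrite mulr_sumr.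
by apply: eq_bigr => p _; rewrite mulrA.
Qed.

Lemma cvg_pseries_sum (I : finType) (a : I -> R) (f : I -> R ^nat) (x : R) :
  (forall l, cvgn (pseries (f l) x)) ->
  pseries (fun k => \sum_l a l * f l k) x @ \oo
    --> \sum_l a l * limn (pseries (f l) x).
Proof.
move=> fc; rewrite pseries_sumE.
by apply: cvg_sumr => l; apply: cvgMl_tmp; exact: fc.
Qed.

(** Termwise differentiation at t asks that the series and its first two formal derivatives converge
    at a point beyond |t|, here |t| + 1. Each formal derivative is a finite linear combination of
    entry series, so all three converge everywhere. *)
Lemma is_mxderive_expm X (t : R) :
  is_mxderive t (fun u => expm (u *: X)) (X *m expm (t *: X)).
Proof.
move=> i j.
under eq_fun do rewrite expmE.
have -> : (X *m expm (t *: X)) i j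
          = limn (pseries (pseries_diffs (expm_coef X i j)) t).
  rewrite pseries_diffs_expm; apply/esym/cvg_lim => //.
  rewrite mxE; under eq_bigr do rewrite expmE.
  by apply: cvg_pseries_sum => l; exact: is_cvg_expm_coef.
apply: (@pseries_snd_diffs _ _ (`|t| + 1)).
- exact: is_cvg_expm_coef.
- rewrite pseries_diffs_expm; apply/cvg_ex; eexists.
  by apply: cvg_pseries_sum => l; exact: is_cvg_expm_coef.
- rewrite pseries_diffs_expm.
  rewrite (_ : pseries_diffs _ =
     fun k => \sum_l X i l * pseries_diffs (expm_coef X l j) k); last first.
    apply/funext => k; rewrite /pseries_diffs mulr_sumr.
    by apply: eq_bigr => l _; rewrite mulrCA.
  apply/cvg_ex; eexists; apply: cvg_pseries_sum => l.
  rewrite pseries_diffs_expm; apply/cvg_ex; eexists.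
  by apply: cvg_pseries_sum => p; exact: is_cvg_expm_coef.
- by rewrite [ltRHS]ger0_norm ?addr_ge0// ltrDl.
Qed.

Lemma expm0 : expm (0 : M) = 1%:M.
Proof.
rewrite -(scale0r (0 : M)); apply/matrixP => i j; rewrite expmE.
apply: lim_near_cst => //; exists 1%N => // -[//|k] _.
rewrite /pseries /series /= big_nat_recl// big1_seq ?addr0.
  by rewrite /expm_coef fact0 invr1 !expr0 mul1r mulr1.
by move=> l _; rewrite expr0n /= mulr0.
Qed.

Lemma continuous_expm X : continuous (fun t : R => expm (t *: X)).
Proof. apply: is_mxderive_continuous => t; exact: is_mxderive_expm. Qed.

(** Lets the action of the exponential on one vector be computed from the vectors X^k w alone,
    without knowing [X] elsewhere. *)
Lemma cvg_expm_mul X (w : 'cV[R]_n.+1) i :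
  series (fun k => (k`!%:R)^-1 * (X ^+ k *m w) i 0) @ \oo --> (expm X *m w) i 0.
Proof.
rewrite mxE -[X in expm X]scale1r; under eq_bigr do rewrite expmE mulrC.
have -> : series (fun k => (k`!%:R)^-1 * (X ^+ k *m w) i 0)
          = pseries (fun k => \sum_l w l 0 * expm_coef X i l k) 1.
  apply/funext => p; rewrite /series/= /pseries/series /=.
  apply: eq_bigr => k _; rewrite expr1n mulr1 mxE mulr_sumr.
  by apply: eq_bigr => l _; rewrite /expm_coef; ring.
by apply: cvg_pseries_sum => l; exact: is_cvg_expm_coef.
Qed.

Lemma expm_eigen X (w : 'cV[R]_n.+1) (c : R) :
  X *m w = c *: w -> expm X *m w = expR c *: w.
Proof.
move=> Xw; apply/colP => i; rewrite [RHS]mxE.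
have Xk k : X ^+ k *m w = c ^+ k *: w.
  elim: k => [|k IH]; first by rewrite !expr0 mul1mx scale1r.
  by rewrite exprSr -mulmxA Xw -scalemxAr IH scalerA exprS.
rewrite -(cvg_lim _ (@cvg_expm_mul X w i))//; apply/cvg_lim => //.
have -> : series (fun k => (k`!%:R)^-1 * (X ^+ k *m w) i 0)
  = (fun k => series (exp_coeff c) k * w i 0).
  apply/funext => p; rewrite /series/= mulr_suml; apply: eq_bigr => k _.
  by rewrite Xk mxE /exp_coeff/=; ring.
by apply: cvgMr_tmp; exact: is_cvg_series_exp_coeff.
Qed.

Lemma expm_fix X (w : 'cV[R]_n.+1) : X *m w = 0 -> expm X *m w = w.
Proof. by move=> Xw; rewrite (@expm_eigen _ _ 0) ?expR0 ?scale1r// scale0r. Qed.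

(** The series stops after its quadratic term; nilpotency is asked only along [w]. *)
Lemma expm_nilp3 X (w : 'cV[R]_n.+1) :
  X *m (X *m (X *m w)) = 0 ->
  expm X *m w = w + X *m w + 2^-1 *: (X *m (X *m w)).
Proof.
move=> X3; apply/colP => i.
have Xk k : X ^+ k.+3 *m w = 0.
  by rewrite !exprSr -!mulmxE -!mulmxA X3 mulmx0.
rewrite -(cvg_lim _ (@cvg_expm_mul X w i))//.
apply: lim_near_cst => //; exists 3%N => // -[//|[//|[//|k]]] _.
rewrite /series /= !big_nat_recl// big1_seq ?addr0; last first.
  by move=> l _; rewrite Xk mxE mulr0.
rewrite expr0 expr1 expr2 -mulmxE -mulmxA mul1mx !mxE /= !factS fact0.
by rewrite invr1 !mul1r -addrA.
Qed.

End Exponential.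

(** * Connected subgroups and pseudo-orthogonal groups *)

Lemma cvg_prodr (R : realType) (T : Type) (F : set_system T) (FF : Filter F)
    (I : finType) (f : I -> T -> R) (l : I -> R) :
  (forall i, f i x @[x --> F] --> l i) ->
  \prod_i f i x @[x --> F] --> \prod_i l i.
Proof.
move=> fl; elim: (index_enum I) => [|i s IH].
  under eq_fun do rewrite big_nil.
  by rewrite big_nil; exact: cvg_cst.
under eq_fun do rewrite big_cons.
by rewrite big_cons; apply: cvgM.
Qed.

Lemma continuous_det (R : realType) n : continuous (fun g : 'M[R]_n => \det g).
Proof.
move=> g; rewrite /determinant; apply: (@cvg_sumr _ _ (nbhs g)) => s.
by apply: cvgMl_tmp; apply: (@cvg_prodr _ _ (nbhs g)) => i; exact: coord_continuous.
Qed.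

(** Intermediate values: the image of [A] is an interval, and a nonpositive value would put 0 in
    it. *)
Lemma continuous_gt0_connected (R : realType) (T : topologicalType) (A : set T)
    (f : T -> R) x :
  connected A -> continuous f -> (forall y, A y -> f y != 0) ->
  A x -> 0 < f x -> forall y, A y -> 0 < f y.
Proof.
move=> Ac fc f0 Ax fx y Ay.
have : connected (f @` A).
  by apply: connected_continuous_connected => //; exact: continuous_subspaceT.
move=> /connected_intervalP itv; rewrite ltNge; apply/negP => fy.
have [z Az z0] : (f @` A) 0.
  apply: (itv (f y) (f x)); [by exists y|by exists x|].
  by rewrite fy (ltW fx).
by move: (f0 z Az); rewrite z0 eqxx.
Qed.

Section ConnectedSubgroup.
Variables (R : realType) (n : nat).
Local Notation M := 'M[R]_n.+1.

Lemma connected_subgroup_expm (l : {vspace M}) X :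
  X \in l -> connected_subgroup l (expm X).
Proof. by move=> Xl K [_ /(_ (expm X))]; apply; exists X. Qed.

(** Minimality of the generated subgroup: an invariant that defines a subgroup has to be checked on
    exponentials only. *)
Lemma connected_subgroup_sub (l : {vspace M}) (K : set M) :
  is_subgroup K -> {in l, forall X, K (expm X)} -> connected_subgroup l `<=` K.
Proof.
by move=> Kg KX g; apply; split=> // _ [X Xl <-]; exact: KX.
Qed.

Lemma unitmx_is_subgroup : is_subgroup [set g : M | g \in unitmx].
Proof.
split => //=; first exact: unitmx1.
  by move=> g h; rewrite unitmx_mul => -> ->.
by move=> g; rewrite unitmx_inv.
Qed.

Lemma connected_subgroup_is_subgroup (l : {vspace M}) :
  {in l, forall X, expm X \in unitmx} -> is_subgroup (connected_subgroup l).
Proof.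
move=> lu; split.
- exact: connected_subgroup_sub unitmx_is_subgroup lu.
- by move=> K [[_ K1 _ _] _].
- by move=> g h gl hl K HK; have [[_ _ KM _] _] := HK; exact: KM (gl K HK) (hl K HK).
- by move=> g gl K HK; have [[_ _ _ KV] _] := HK; exact: KV (gl K HK).
Qed.

End ConnectedSubgroup.

(** * The special pseudo-orthogonal group and its identity component *)

Section PseudoOrthogonal.
Variables (R : realType) (l : nat).
Local Notation M := 'M[R]_l.+1.
Local Notation eta := (eta R l).

Lemma trmx_eta : eta^T = eta.
Proof. exact: tr_diag_mx. Qed.

Lemma eta_sqr : eta *m eta = 1%:M.
Proof.
rewrite mulmx_diag -diag_const_mx; congr diag_mx.
apply/rowP => i; rewrite !mxE; case: ifP => _; first by rewrite mul1r.
by rewrite mulrNN mul1r.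
Qed.

Lemma soP (X : M) : X \in so R l <-> X^T *m eta + eta *m X = 0.
Proof.
rewrite /so memv_ker lfunE /=; split; first by move/eqP.
by move=> ->.
Qed.

Definition SOset : set M := [set g | g^T *m eta *m g = eta /\ \det g = 1].

Lemma SOset1 : SOset 1%:M.
Proof. by split; rewrite ?det1// trmx1 mul1mx mulmx1. Qed.

Lemma orthV (g : M) : g^T *m eta *m g = eta -> g \in unitmx /\
  invmx g = eta *m g^T *m eta.
Proof.
move=> gE.
have gK : (eta *m g^T *m eta) *m g = 1%:M.
  by rewrite -!mulmxA (mulmxA g^T) gE eta_sqr.
have gu : g \in unitmx by have [] := mulmx1_unit gK.
split=> //; apply: (can_inj (mulmxK gu)).
by rewrite mulVmx.
Qed.

Lemma SOsetM (g h : M) : SOset g -> SOset h -> SOset (g *m h).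
Proof.
move=> [gE gd] [hE hd]; split; last by rewrite det_mulmx gd hd mulr1.
by rewrite trmx_mul -!mulmxA (mulmxA eta) (mulmxA g^T) (mulmxA g^T) gE mulmxA hE.
Qed.

Lemma SOset_unit (g : M) : SOset g -> g \in unitmx.
Proof. by move=> [/orthV[]]. Qed.

Lemma SOsetV (g : M) : SOset g -> SOset (invmx g).
Proof.
move=> gS; have gu := SOset_unit gS; have [gE gd] := gS.
split; last by rewrite det_inv gd invr1.
by rewrite -{1}gE !mulmxA -trmx_mul mulmxV// trmx1 mul1mx -mulmxA mulmxV// mulmx1.
Qed.

Lemma Ggrp_SOset : Ggrp (R:=R) (l:=l) `<=` SOset.
Proof. exact: connected_component_sub. Qed.

Lemma Ggrp1 : Ggrp (1%:M : M).
Proof. exact/connected_component_refl/SOset1. Qed.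

Lemma continuous_mulmxl m n p (g : 'M[R]_(m, n)) :
  continuous (fun h : 'M[R]_(n, p) => g *m h).
Proof. by apply: continuous_mulmx; [exact: cst_continuous|move=> h A]. Qed.

(** A connected part of the special orthogonal group that meets the identity component stays inside
    it. Products, inverses and exponentials are all placed in [Ggrp] this way. *)
Lemma connected_Ggrp (A : set M) g h :
  connected A -> A `<=` SOset -> A g -> A h -> Ggrp g -> Ggrp h.
Proof.
move=> Ac AS Ag Ah gG.
by apply: (connected_component_trans gG); exists A.
Qed.

Lemma connected_mulmxl (g : M) (A : set M) :
  connected A -> connected ((fun h => g *m h) @` A).
Proof.
move=> Ac; apply: connected_continuous_connected => //.
by apply: continuous_subspaceT; exact: continuous_mulmxl.
Qed.

(** The left translate of the component by [g] is connected and contains both g = g 1 and g h. *)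
Lemma GgrpM (g h : M) : Ggrp g -> Ggrp h -> Ggrp (g *m h).
Proof.
move=> gG hG; have gS := Ggrp_SOset gG.
apply: (@connected_Ggrp ((fun h => g *m h) @` @Ggrp R l) g) => //.
- exact/connected_mulmxl/component_connected.
- by move=> _ [k kG <-]; exact: SOsetM (Ggrp_SOset kG).
- by exists 1%:M; [exact: Ggrp1|rewrite mulmx1].
- by exists h.
Qed.

Lemma GgrpV (g : M) : Ggrp g -> Ggrp (invmx g).
Proof.
move=> gG; have gS := Ggrp_SOset gG.
apply: (@connected_Ggrp ((fun h => invmx g *m h) @` @Ggrp R l) 1%:M) => //.
- exact/connected_mulmxl/component_connected.
- by move=> _ [k kG <-]; exact: SOsetM (SOsetV gS) (Ggrp_SOset kG).
- by exists g; rewrite ?mulVmx// SOset_unit.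
- by exists 1%:M; [exact: Ggrp1|rewrite mulmx1].
- exact: Ggrp1.
Qed.

Lemma Ggrp_is_subgroup : is_subgroup (@Ggrp R l).
Proof.
split; [by move=> g /Ggrp_SOset/SOset_unit|exact: Ggrp1|exact: GgrpM|exact: GgrpV].
Qed.

(** The left side is constant in t: its derivative contains the factor X^T eta + eta X = 0. *)
Lemma expm_orth (X : M) (t : R) : X \in so R l ->
  (expm (t *: X))^T *m eta *m expm (t *: X) = eta.
Proof.
move=> /soP Xs; set F := fun t => (expm (t *: X))^T *m eta *m expm (t *: X).
rewrite -/(F t) (@is_mxderive0_cst _ _ _ F _ t 0).
  by rewrite /F scale0r expm0 trmx1 mul1mx mulmx1.
move=> u.
have := is_mxderive_mul (is_mxderive_mul (is_mxderive_trmx (is_mxderive_expm X u))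
  (is_mxderive_cst u eta)) (is_mxderive_expm X u).
congr is_mxderive.
rewrite mulmx0 addr0 trmx_mul -!mulmxA -mulmxDr (mulmxA X^T) (mulmxA eta).
by rewrite -mulmxDl Xs mul0mx mulmx0.
Qed.

Lemma det_orth (g : M) : g^T *m eta *m g = eta -> \det g != 0.
Proof. by move=> /orthV[]; rewrite unitmxE unitfE. Qed.

(** The determinant has square 1; along the path it never vanishes and starts at 1, so it is
    positive. *)
Lemma expm_SOset (X : M) (t : R) : X \in so R l -> SOset (expm (t *: X)).
Proof.
move=> Xs; have gE := expm_orth t Xs; split=> //.
have : 0 < \det (expm (t *: X)).
  apply: (@continuous_gt0_connected _ R setT (fun u : R => \det (expm (u *: X))) 0) => //.
  - by apply/connected_intervalP => x y _ _ z _.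
  - move=> u.
    exact: (continuous_comp (@continuous_expm _ _ X u) (@continuous_det _ _ _)).
  - by move=> u _; apply: det_orth; exact: expm_orth.
  - by rewrite scale0r expm0 det1.
have : (\det (expm (t *: X))) ^+ 2 = 1.
  have := congr1 determinant gE; rewrite !det_mulmx det_tr => /eqP.
  have e0 : \det eta != 0.
    have := congr1 determinant eta_sqr.
    rewrite det_mulmx det1 => e; apply/eqP => e0.
    by move: e; rewrite e0 mul0r => /esym/eqP; rewrite oner_eq0.
  by rewrite mulrAC -expr2 -subr_eq0 -{2}[\det eta]mul1r -mulrBl mulf_eq0
    (negPf e0) orbF subr_eq0 => /eqP.
by move=> /eqP; rewrite sqrf_eq1 => /orP[/eqP//|/eqP->]; rewrite oppr_gt0 ltr10.
Qed.

Lemma expm_Ggrp (X : M) : X \in so R l -> Ggrp (expm X).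
Proof.
move=> Xs; apply: (@connected_Ggrp ((fun t : R => expm (t *: X)) @` setT) 1%:M).
- apply: connected_continuous_connected; last first.
    by apply: continuous_subspaceT; exact: continuous_expm.
  by apply/connected_intervalP => x y _ _ z _.
- by move=> _ [t _ <-]; exact: expm_SOset.
- by exists 0; rewrite // scale0r expm0.
- by exists 1; rewrite // scale1r.
- exact: Ggrp1.
Qed.

Lemma lie_algebra_HgrpP (v : 'cV[R]_l.+1) (X : M) :
  X \in so R l -> lie_algebra (Hgrp v) X <-> X *m v = 0.
Proof.
move=> Xs; split=> [XH|Xv t].
  have D0 := is_mxderive_mul (is_mxderive_expm X 0) (is_mxderive_cst 0 v).
  rewrite scale0r expm0 mulmx0 addr0 mulmx1 in D0.
  have Hc : (fun u : R => expm (u *: X) *m v) = (fun _ => v).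
    by apply/funext => u; have [] := XH u.
  rewrite Hc in D0; apply/matrixP => i j.
  (* The curve exp(uX) v is constant, so its derivative at 0 is both [X *m v] and 0. *)
  have [_ E1] := D0 i j; have [_ E2] := is_mxderive_cst 0 v i j.
  by rewrite -E1 E2.
split; first by apply: expm_Ggrp; rewrite memvZ.
by apply: expm_fix; rewrite -scalemxAl Xv scaler0.
Qed.

Lemma lcosetP (K : set M) g h : is_subgroup K -> g \in unitmx ->
  lcoset K g = lcoset K h <-> K (invmx g *m h).
Proof.
move=> [Ku K1 KM KV] gu; split=> [E|Kgh].
  have [k Kk <-] : lcoset K g h by rewrite E; exists 1%:M; rewrite ?mulmx1.
  by rewrite mulKmx.
have -> : h = g *m (invmx g *m h) by rewrite mulKVmx.
move: (invmx g *m h) Kgh => p Kp; have pu := Ku _ Kp.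
apply/seteqP; split=> _ [k Kk <-].
  exists (invmx p *m k); first by apply: KM => //; exact: KV.
  by rewrite -mulmxA mulKVmx.
by exists (p *m k); [exact: KM|rewrite mulmxA].
Qed.

Lemma Hgrp_is_subgroup (v : 'cV[R]_l.+1) : is_subgroup (Hgrp v).
Proof.
have [Gu G1 GM GV] := Ggrp_is_subgroup.
split=> [g [/Gu]//||g h [gG gv] [hG hv]|g [gG gv]] /=.
- by split=> //; rewrite mul1mx.
- by split; [exact: GM|rewrite -mulmxA hv].
- by split; [exact: GV|rewrite -{1}gv mulKmx// Gu].
Qed.

(** The map [g] to g v embeds G/H in the hyperboloid of vectors of the norm of [v]; it lets points
    of anti-de Sitter space be handled as vectors. *)
Lemma lcoset_HgrpP (v : 'cV[R]_l.+1) g h : Ggrp g -> Ggrp h ->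
  lcoset (Hgrp v) g = lcoset (Hgrp v) h <-> g *m v = h *m v.
Proof.
have [Gu G1 GM GV] := Ggrp_is_subgroup => gG hG.
rewrite lcosetP; [|exact: Hgrp_is_subgroup|exact: Gu].
split=> [[_ E]|E].
  by rewrite -[in LHS]E !mulmxA mulmxV ?mul1mx//; exact: Gu.
split; first by apply: GM => //; exact: GV.
by rewrite -mulmxA -E mulKmx//; exact: Gu.
Qed.

Lemma lcosetM (K : set M) g h : lcoset K (g *m h) = act g (lcoset K h).
Proof.
apply/seteqP; split=> [_ [k Kk <-]|_ [_ [k Kk <-] <-]].
  by exists (h *m k); [exists k|rewrite mulmxA].
by exists k; rewrite ?mulmxA.
Qed.

End PseudoOrthogonal.

(** * The bilinear form and root spaces *)

Section BilinearForm.
Variables (R : realType) (l : nat).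
Local Notation eta := (eta R l).
Implicit Types (u w : 'cV[R]_l.+1) (X g : 'M[R]_l.+1).

Definition bil u w : R := (u^T *m eta *m w) 0 0.

Lemma bilDl u u' w : bil (u + u') w = bil u w + bil u' w.
Proof. by rewrite /bil raddfD /= !mulmxDl mxE. Qed.

Lemma bilZl c u w : bil (c *: u) w = c * bil u w.
Proof. by rewrite /bil linearZ /= -!scalemxAl mxE. Qed.

Lemma bilC u w : bil u w = bil w u.
Proof.
rewrite /bil -[in RHS](trmxK (w^T *m eta *m u)) [in RHS]mxE.
by rewrite !trmx_mul trmxK trmx_eta mulmxA.
Qed.

Lemma bilDr u w w' : bil u (w + w') = bil u w + bil u w'.
Proof. by rewrite bilC bilDl !(bilC u). Qed.

Lemma bilZr c u w : bil u (c *: w) = c * bil u w.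
Proof. by rewrite bilC bilZl bilC. Qed.

Lemma bilNl u w : bil (- u) w = - bil u w.
Proof. by rewrite -scaleN1r bilZl mulN1r. Qed.

Lemma bilNr u w : bil u (- w) = - bil u w.
Proof. by rewrite bilC bilNl bilC. Qed.

Lemma bil0l w : bil 0 w = 0.
Proof. by rewrite -(scale0r 0) bilZl mul0r. Qed.

Lemma bil0r u : bil u 0 = 0.
Proof. by rewrite bilC bil0l. Qed.

Definition bilE :=
  (bilDl, bilDr, bilNl, bilNr, bilZl, bilZr, bil0l, bil0r).

Lemma bil_so X u w : X \in so R l -> bil (X *m u) w = - bil u (X *m w).
Proof.
move=> /soP /eqP; rewrite addr_eq0 => /eqP XE.
by rewrite /bil trmx_mul -!mulmxA (mulmxA X^T) XE mulNmx mulmxN mxE !mulmxA.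
Qed.

Lemma bil_orth g u w : g^T *m eta *m g = eta -> bil (g *m u) (g *m w) = bil u w.
Proof.
by move=> gE; rewrite /bil trmx_mul -!mulmxA (mulmxA eta) (mulmxA g^T)
  (mulmxA g^T) gE mulmxA.
Qed.

Lemma bil_nondeg u : (forall w, bil u w = 0) -> u = 0.
Proof.
move=> u0; have : u^T *m eta = 0.
  apply/rowP => j; rewrite [RHS]mxE -(u0 (delta_mx j 0)) /bil -colE.
  by rewrite [RHS]mxE.
move=> /(congr1 (mulmx^~ eta)); rewrite -mulmxA eta_sqr mulmx1 mul0mx.
by move=> /(congr1 trmx); rewrite trmxK trmx0.
Qed.

End BilinearForm.

(** The square matrix with rows u_i is row-free, hence invertible, and its inverse gives the
    coordinates. *)
Lemma free_span (R : realType) n (u : 'I_n -> 'cV[R]_n) :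
  (forall c : 'I_n -> R, \sum_i c i *: u i = 0 -> forall i, c i = 0) ->
  forall w, exists c : 'I_n -> R, w = \sum_i c i *: u i.
Proof.
move=> ufree w; pose A := \matrix_i (u i)^T.
have AE (c : 'rV[R]_n) : c *m A = (\sum_i c 0 i *: u i)^T.
  rewrite mulmx_sum_row raddf_sum; apply: eq_bigr => i _.
  by apply/rowP => j; rewrite !mxE.
have Au : A \in unitmx.
  rewrite -row_free_unit; apply: inj_row_free => c.
  rewrite AE => /(congr1 trmx); rewrite trmxK trmx0 => /ufree c0.
  by apply/rowP => i; rewrite c0 mxE.
exists (fun i => (w^T *m invmx A) 0 i).
by rewrite -[RHS]trmxK -AE mulmxKV// trmxK.
Qed.

Section RootSpaces.
Variables (R : realType) (n : nat).
Local Notation M := 'M[R]_n.+1.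
Implicit Types (X Y Z : M) (g : {vspace M}).

Lemma leigenspaceP (f : 'End(M)) c X :
  X \in passmx.leigenspace f c <-> f X = c *: X.
Proof.
rewrite memv_ker !lfunE/= lfunE /= lfunE/= subr_eq0.
rewrite id_lfunE; split=> [/eqP//|->//].
Qed.

Lemma eigen_inP g (f : 'End(M)) c X :
  X \in eigen_in g f c <-> X \in g /\ f X = c *: X.
Proof.
rewrite memv_cap; split; first by move=> /andP[-> /leigenspaceP].
by move=> [-> /leigenspaceP].
Qed.

Lemma adE X Y : ad X Y = lie X Y.
Proof. by rewrite lfunE. Qed.

Lemma root_spaceP g J1 J2 alpha beta X :
  X \in root_space g J1 J2 alpha beta <->
  [/\ X \in g, lie J1 X = alpha *: X & lie J2 X = beta *: X].
Proof.
rewrite /root_space !memv_cap; split.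
  by move=> /andP[/andP[-> /leigenspaceP + /leigenspaceP +]]; rewrite !adE.
by move=> [-> e1 e2]; apply/andP; split; apply/leigenspaceP; rewrite adE.
Qed.

Lemma lieZl c X Y : lie (c *: X) Y = c *: lie X Y.
Proof. by rewrite /lie -scalemxAl -scalemxAr scalerBr. Qed.
Lemma lieC X Y : lie X Y = - lie Y X.
Proof. by rewrite /lie opprB. Qed.
Lemma lieZr c X Y : lie X (c *: Y) = c *: lie X Y.
Proof. by rewrite lieC lieZl -scalerN -lieC. Qed.
Lemma lieNl X Y : lie (- X) Y = - lie X Y.
Proof. by rewrite -scaleN1r lieZl scaleN1r. Qed.
Lemma lieNr X Y : lie X (- Y) = - lie X Y.
Proof. by rewrite -scaleN1r lieZr scaleN1r. Qed.

Lemma lie_jacobi X Y Z : lie X (lie Y Z) = lie (lie X Y) Z + lie Y (lie X Z).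
Proof.
rewrite /lie !mulmxBl !mulmxBr !mulmxA.
set a := X *m Y *m Z; set b := X *m Z *m Y; set c := Y *m Z *m X.
set d := Z *m Y *m X; set e := Y *m X *m Z; set f := Z *m X *m Y.
by apply/matrixP => i j; rewrite !mxE; ring.
Qed.

Lemma lie_mulmx X Y Z (w : 'cV[R]_n.+1) :
  lie X Y = Z -> X *m (Y *m w) = Y *m (X *m w) + Z *m w.
Proof. by move=> <-; rewrite /lie mulmxBl !mulmxA addrC subrK. Qed.

End RootSpaces.

Lemma lie_so (R : realType) l (X Y : 'M[R]_l.+1) :
  X \in so R l -> Y \in so R l -> lie X Y \in so R l.
Proof.
move=> /soP/eqP; rewrite addr_eq0 => /eqP XE.
move=> /soP/eqP; rewrite addr_eq0 => /eqP YE.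
apply/soP; rewrite /lie raddfB /= !trmx_mul mulmxBl mulmxBr.
rewrite -!mulmxA XE YE !mulmxN !mulmxA XE YE !mulNmx !opprK.
by rewrite addrC addrA subrK subrr.
Qed.

(** * Closed orbits *)

(** The facts about the action that decide which orbits are closed, stated once so that they can be
    instantiated for both AN and A Nbar. The four vectors are null and span two orthogonal
    hyperbolic planes, [ep], [em] and [fp], [fm]. [X1] and [X2] are the root vectors of [n], and [Y]
    moves [v] off the hyperplane orthogonal to [ep]. *)
Record null_frame (R : realType) (a n : {vspace 'M[R]_4})
    (v ep em fp fm : 'cV[R]_4) (J1 J2 X1 X2 Y : 'M[R]_4) : Prop := NullFrame {
  frame_v : v = fp + fm;
  frame_epep : bil ep ep = 0;
  frame_emem : bil em em = 0;
  frame_epem : bil ep em = - 2^-1;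
  frame_fpfp : bil fp fp = 0;
  frame_fmfm : bil fm fm = 0;
  frame_fpfm : bil fp fm = 2^-1;
  frame_epfp : bil ep fp = 0;
  frame_epfm : bil ep fm = 0;
  frame_emfp : bil em fp = 0;
  frame_emfm : bil em fm = 0;
  frame_span : forall w, exists c1 c2 c3 c4,
    w = c1 *: ep + c2 *: em + c3 *: fp + c4 *: fm;
  frame_a : forall X, X \in a ->
    [/\ X \in so R 3, exists c, X *m ep = c *: ep & exists c, X *m fm = c *: fm];
  frame_n : forall X, X \in n ->
    [/\ X \in so R 3, X *m ep = 0 & exists c, X *m fm = c *: ep];
  frame_J1 : J1 \in a;
  frame_J2 : J2 \in a;
  frame_X1 : X1 \in n;
  frame_X2 : X2 \in n;
  frame_Y : Y \in so R 3;
  frame_J1ep : J1 *m ep = ep;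
  frame_J1em : J1 *m em = - em;
  frame_J1fp : J1 *m fp = 0;
  frame_J1fm : J1 *m fm = 0;
  frame_J2ep : J2 *m ep = 0;
  frame_J2fp : J2 *m fp = fp;
  frame_J2fm : J2 *m fm = - fm;
  frame_X1em : X1 *m em = fp;
  frame_X1fp : X1 *m fp = 0;
  frame_X1fm : X1 *m fm = ep;
  frame_X2em : X2 *m em = - fm;
  frame_X2fp : X2 *m fp = - ep;
  frame_X2fm : X2 *m fm = 0;
  frame_Yv : Y *m v = em;
  frame_Yem : Y *m em = 0
}.

Section ClosedOrbits.
Variables (R : realType) (a n : {vspace 'M[R]_4}).
Variables (v ep em fp fm : 'cV[R]_4) (J1 J2 X1 X2 Y : 'M[R]_4).
Hypothesis F : null_frame a n v ep em fp fm J1 J2 X1 X2 Y.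
Local Notation M := 'M[R]_4.
Local Notation G := (@Ggrp R 3).
Local Notation H := (Hgrp v).
Local Notation L :=
  [set r *m s | r in connected_subgroup a & s in connected_subgroup n].

(** The stabilizer of an oriented flag: the ray of [ep] and the ray of [fm] modulo [ep] are kept,
    both with positive factors. It contains the acting group, and positivity is what makes signs of
    B invariant along orbits. *)
Definition flag_stabilizer : set M := [set g | [/\ G g,
  exists2 c, 0 < c & g *m ep = c *: ep &
  exists2 c, 0 < c & exists d, g *m fm = c *: fm + d *: ep]].

Lemma flag_stabilizer_is_subgroup : is_subgroup flag_stabilizer.
Proof.
have [Gu G1 GM GV] := Ggrp_is_subgroup R 3.
split=> [g [/Gu]//||g h [Gg [c c0 gc] [d d0 [e gd]]] [Gh [c' c'0 hc] [d' d'0 [e' hd]]]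
  |g [Gg [c c0 gc] [d d0 [e gd]]]].
- split; first exact: G1.
    by exists 1; rewrite // mul1mx scale1r.
  by exists 1; rewrite //; exists 0; rewrite mul1mx scale1r scale0r addr0.
- split; first exact: GM.
    by exists (c' * c); rewrite ?mulr_gt0// -mulmxA hc -scalemxAr gc scalerA.
  exists (d' * d); first by rewrite mulr_gt0.
  exists (d' * e + e' * c).
  rewrite -mulmxA hd mulmxDr -!scalemxAr gc gd scalerDr !scalerA -addrA.
  by rewrite -scalerDl.
- have gV : invmx g *m ep = c^-1 *: ep.
    apply: (can_inj (mulKmx (Gu _ Gg))).
    by rewrite mulKVmx ?Gu// -scalemxAr gc scalerA mulVf ?scale1r// gt_eqF.
  split; first exact: GV.
    by exists c^-1; rewrite ?invr_gt0.
  exists d^-1; first by rewrite invr_gt0.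
  (* The [ep] coefficient z solving g (d^-1 fm + z ep) = fm, given g ep = c ep and g fm = d fm + e
     ep. *)
  exists (- (d^-1 * e * c^-1)).
  apply: (can_inj (mulKmx (Gu _ Gg))).
  rewrite mulKVmx ?Gu// mulmxDr -!scalemxAr gc gd scalerDr !scalerA.
  rewrite mulVf ?gt_eqF// scale1r -addrA -scalerDl mulNr divfK ?gt_eqF//.
  by rewrite subrr scale0r addr0.
Qed.

Lemma subgroup_a_flag : connected_subgroup a `<=` flag_stabilizer.
Proof.
apply: connected_subgroup_sub; first exact: flag_stabilizer_is_subgroup.
move=> X /(frame_a F)[Xs [c Xc] [d Xd]]; split; first exact: expm_Ggrp.
  by exists (expR c); rewrite ?expR_gt0// (expm_eigen Xc).
exists (expR d); rewrite ?expR_gt0//; exists 0.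
by rewrite (expm_eigen Xd) scale0r addr0.
Qed.

Lemma subgroup_n_flag : connected_subgroup n `<=` flag_stabilizer.
Proof.
apply: connected_subgroup_sub; first exact: flag_stabilizer_is_subgroup.
move=> X /(frame_n F)[Xs Xc [d Xd]]; split; first exact: expm_Ggrp.
  by exists 1; rewrite // (expm_fix Xc) scale1r.
exists 1; rewrite //; exists d.
by rewrite expm_nilp3 Xd -!scalemxAr Xc ?mulmx0 !scaler0 ?mulmx0// addr0 scale1r.
Qed.

Lemma L_flag : L `<=` flag_stabilizer.
Proof.
have [_ _ KM _] := flag_stabilizer_is_subgroup.
move=> _ [r /subgroup_a_flag rK] [s /subgroup_n_flag sK] <-; exact: KM.
Qed.

Lemma L1 : L 1%:M.
Proof.
exists 1%:M; last exists 1%:M; rewrite ?mulmx1//.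
  by move=> K [[]].
by move=> K [[]].
Qed.

Lemma flag_bil_ep g w : flag_stabilizer g ->
  exists2 c, 0 < c & bil (g *m w) ep = c * bil w ep.
Proof.
move=> [/Ggrp_SOset[gE _] [c c0 gc] _]; exists c^-1; rewrite ?invr_gt0//.
by rewrite -(bil_orth w ep gE) gc bilZr mulKf ?gt_eqF.
Qed.

(** On the hyperplane orthogonal to [ep], which is preserved, the [ep] part of g fm contributes
    nothing; so the sign of B(., fm) is an invariant there. *)
Lemma flag_bil_fm g w : flag_stabilizer g -> bil w ep = 0 ->
  exists2 c, 0 < c & bil (g *m w) fm = c * bil w fm.
Proof.
move=> gK w0; have [c1 _] := flag_bil_ep w gK; rewrite w0 mulr0 => gw0.
have [/Ggrp_SOset[gE _] _ [c c0 [d gc]]] := gK.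
exists c^-1; rewrite ?invr_gt0//.
by rewrite -(bil_orth w fm gE) gc !bilE gw0 mulr0 addr0 mulKf ?gt_eqF.
Qed.

Lemma frame_gram :
  ((bil ep ep = 0) * (bil em em = 0) * (bil ep em = - 2^-1) *
   (bil em ep = - 2^-1) * (bil fp fp = 0) * (bil fm fm = 0) *
   (bil fp fm = 2^-1) * (bil fm fp = 2^-1) * (bil ep fp = 0) *
   (bil fp ep = 0) * (bil ep fm = 0) * (bil fm ep = 0) * (bil em fp = 0) *
   (bil fp em = 0) * (bil em fm = 0) * (bil fm em = 0))%type.
Proof.
by do !split; first [ exact: frame_epep F | exact: frame_emem F
  | exact: frame_epem F | by rewrite bilC; exact: frame_epem F
  | exact: frame_fpfp F | exact: frame_fmfm F
  | exact: frame_fpfm F | by rewrite bilC; exact: frame_fpfm F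
  | exact: frame_epfp F | by rewrite bilC; exact: frame_epfp F
  | exact: frame_epfm F | by rewrite bilC; exact: frame_epfm F
  | exact: frame_emfp F | by rewrite bilC; exact: frame_emfp F
  | exact: frame_emfm F | by rewrite bilC; exact: frame_emfm F ].
Qed.

(* exp (t J1) fixes fp and fm and scales em by any positive factor;
   exp (u X1 + u' X2) moves em by any combination of fp and fm. *)
Lemma L_transitive_open w w' : bil w w = 1 -> bil w' w' = 1 ->
  0 < bil w ep * bil w' ep -> exists2 g, L g & g *m w = w'.
Proof.
have [p [m [k [q ->]]]] := frame_span F w.
have [p' [m' [k' [q' ->]]]] := frame_span F w'.
rewrite !bilE !frame_gram => e e' m0.
have {}m0 : 0 < m * m' by lra.
have mN0 : m != 0 by apply: contraTneq m0 => ->; rewrite mul0r ltxx.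
have m'N0 : m' != 0 by apply: contraTneq m0 => ->; rewrite mulr0 ltxx.
have lam0 : 0 < m' / m.
  have -> : m' / m = (m * m') * (m^-1) ^+ 2 by field.
  by rewrite mulr_gt0// exprn_even_gt0//= invr_eq0.
(* exp N turns the [fp] and [fm] coefficients k, q into k', q' and keeps the [em] coefficient m;
   exp(t J1) then scales m to m'. *)
pose u := (k' - k) / m; pose u' := (q - q') / m.
pose t := - ln (m' / m); pose N := u *: X1 + u' *: X2.
have Nn : N \in n.
  by rewrite memvD ?memvZ ?(frame_X1 F)// (frame_X2 F).
exists (expm (t *: J1) *m expm N).
  exists (expm (t *: J1)).
    by apply: connected_subgroup_expm; rewrite memvZ// (frame_J1 F).
  by exists (expm N); first exact: connected_subgroup_expm.
have [_ Nep _] := frame_n F Nn.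
have Nfp : N *m fp = - u' *: ep.
  by rewrite mulmxDl -!scalemxAl (frame_X1fp F) (frame_X2fp F) scaler0 add0r
    scalerN scaleNr.
have Nfm : N *m fm = u *: ep.
  by rewrite mulmxDl -!scalemxAl (frame_X1fm F) (frame_X2fm F) scaler0 addr0.
have Nem : N *m em = u *: fp - u' *: fm.
  by rewrite mulmxDl -!scalemxAl (frame_X1em F) (frame_X2em F) scalerN.
have sep : expm N *m ep = ep by exact: expm_fix.
have sfp : expm N *m fp = fp - u' *: ep.
  rewrite expm_nilp3 Nfp -!scalemxAr Nep ?mulmx0 !scaler0 ?mulmx0// addr0.
  by rewrite scaleNr.
have sfm : expm N *m fm = fm + u *: ep.
  by rewrite expm_nilp3 Nfm -!scalemxAr Nep ?mulmx0 !scaler0 ?mulmx0// addr0.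
have NNem : N *m (N *m em) = - (2 * u * u') *: ep.
  rewrite Nem mulmxBr -!scalemxAr Nfp Nfm !scalerA -scalerBl.
  by congr (_ *: _); ring.
have sem : expm N *m em = em + u *: fp - u' *: fm - (u * u') *: ep.
  rewrite expm_nilp3 NNem; last by rewrite -scalemxAr Nep scaler0.
  by rewrite Nem; apply/matrixP => i j; rewrite !mxE; field.
have rep : expm (t *: J1) *m ep = (m / m') *: ep.
  rewrite (@expm_eigen _ _ _ _ t); last by rewrite -scalemxAl (frame_J1ep F).
  by rewrite /t expRN lnK ?posrE// invf_div.
have rem : expm (t *: J1) *m em = (m' / m) *: em.
  rewrite (@expm_eigen _ _ _ _ (- t)); last first.
    by rewrite -scalemxAl (frame_J1em F) scalerN -scaleNr.
  by rewrite /t opprK lnK ?posrE.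
have rfp : expm (t *: J1) *m fp = fp.
  by apply: expm_fix; rewrite -scalemxAl (frame_J1fp F) scaler0.
have rfm : expm (t *: J1) *m fm = fm.
  by apply: expm_fix; rewrite -scalemxAl (frame_J1fm F) scaler0.
move: (expm N) (expm (t *: J1)) sep sfp sfm sem rep rem rfp rfm.
move=> S T sep sfp sfm sem rep rem rfp rfm.
rewrite -!mulmxA !mulmxDr -!scalemxAr sep sem sfp sfm.
rewrite !(mulmxDr, mulmxN) -!scalemxAr rep rem rfp rfm.
(* The [ep] coefficients need no adjustment: square norm 1 reads k q - p m = 1, which determines p
   from the other three. *)
have kq : k * q = 1 + p * m by lra.
have kq' : k' * q' = 1 + p' * m' by lra.
have pE : p = (k * q - 1) / m by rewrite kq; field.
have p'E : p' = (k' * q' - 1) / m' by rewrite kq'; field.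
apply/matrixP => i j; rewrite !mxE pE p'E /u /u'; field.
by rewrite mN0 m'N0.
Qed.

(** Here the [em] coefficient vanishes and norm 1 reads k q = 1. So k is nonzero, and the weak
    inequality, a closed condition, already forces k and k' to have the same sign. *)
Lemma L_transitive_wall w w' : bil w w = 1 -> bil w' w' = 1 ->
  bil w ep = 0 -> bil w' ep = 0 ->
  0 <= bil w fm * bil w' fm -> exists2 g, L g & g *m w = w'.
Proof.
have [p [m [k [q ->]]]] := frame_span F w.
have [p' [m' [k' [q' ->]]]] := frame_span F w'.
rewrite !bilE !frame_gram => e e' m0 m'0.
have {}m0 : m = 0 by lra.
have {}m'0 : m' = 0 by lra.
move=> kk'; rewrite m0 in e kk' *; rewrite m'0 in e' kk' *.
have kq : k * q = 1 by lra.
have kq' : k' * q' = 1 by lra.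
have kN0 : k != 0 by apply: contra_eq_neq kq => ->; rewrite mul0r eq_sym oner_neq0.
have qN0 : q != 0 by apply: contra_eq_neq kq => ->; rewrite mulr0 eq_sym oner_neq0.
have k'N0 : k' != 0 by apply: contra_eq_neq kq' => ->; rewrite mul0r eq_sym oner_neq0.
have {}kk' : 0 < k * k'.
  by rewrite lt_neqAle eq_sym mulf_neq0//=; lra.
have lam0 : 0 < k' / k.
  have -> : k' / k = (k * k') * (k^-1) ^+ 2 by field.
  by rewrite mulr_gt0// exprn_even_gt0//= invr_eq0.
(* exp(u X1) corrects the [ep] coefficient by u q; exp(t J2) then multiplies k by k'/k and q by the
   inverse, leaving [ep] fixed. *)
pose u := (p' - p) / q; pose t := ln (k' / k); pose N := u *: X1.
have Nn : N \in n by rewrite memvZ// (frame_X1 F).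
exists (expm (t *: J2) *m expm N).
  exists (expm (t *: J2)).
    by apply: connected_subgroup_expm; rewrite memvZ// (frame_J2 F).
  by exists (expm N); first exact: connected_subgroup_expm.
have [_ Nep _] := frame_n F Nn.
have sep : expm N *m ep = ep by exact: expm_fix.
have sfp : expm N *m fp = fp.
  by apply: expm_fix; rewrite -scalemxAl (frame_X1fp F) scaler0.
have Nfm : N *m fm = u *: ep by rewrite -scalemxAl (frame_X1fm F).
have sfm : expm N *m fm = fm + u *: ep.
  by rewrite expm_nilp3 Nfm -!scalemxAr Nep ?mulmx0 !scaler0 ?mulmx0// addr0.
have rep : expm (t *: J2) *m ep = ep.
  by apply: expm_fix; rewrite -scalemxAl (frame_J2ep F) scaler0.
have rfp : expm (t *: J2) *m fp = (k' / k) *: fp.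
  rewrite (@expm_eigen _ _ _ _ t); last by rewrite -scalemxAl (frame_J2fp F).
  by rewrite /t lnK ?posrE.
have rfm : expm (t *: J2) *m fm = (k / k') *: fm.
  rewrite (@expm_eigen _ _ _ _ (- t)); last first.
    by rewrite -scalemxAl (frame_J2fm F) scalerN -scaleNr.
  by rewrite /t expRN lnK ?posrE// invf_div.
rewrite !scale0r !addr0.
move: (expm N) (expm (t *: J2)) sep sfp sfm rep rfp rfm.
move=> S T sep sfp sfm rep rfp rfm.
rewrite -!mulmxA !mulmxDr -!scalemxAr sep sfp sfm.
rewrite !(mulmxDr, mulmxN) -!scalemxAr rep rfp rfm.
have qE : q = k^-1 by apply: (mulfI kN0); rewrite kq mulfV.
have q'E : q' = k'^-1 by apply: (mulfI k'N0); rewrite kq' mulfV.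
apply/matrixP => i j; rewrite !mxE /u q'E qE; field.
by rewrite kN0 k'N0.
Qed.

Lemma bil_vv1 : bil v v = 1.
Proof. by rewrite (frame_v F) !bilE !frame_gram; lra. Qed.

Lemma bil_vep : bil v ep = 0.
Proof. by rewrite (frame_v F) !bilE !frame_gram addr0. Qed.

Lemma continuous_bil u : continuous (fun g : M => bil (g *m v) u).
Proof.
under eq_fun do rewrite bilC /bil mulmxA.
have c : continuous (fun g : M => u^T *m eta R 3 *m g *m v).
  apply: continuous_mulmx; last exact: cst_continuous.
  exact: continuous_mulmxl.
move=> g; exact: (continuous_comp (c g) (@coord_continuous _ _ _ 0 0 _)).
Qed.

Lemma Ggrp_bil g : G g -> bil (g *m v) (g *m v) = 1.
Proof. by move=> /Ggrp_SOset[gE _]; rewrite bil_orth// bil_vv1. Qed.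

Lemma lcoset_Ggrp g h : G g -> lcoset H h = lcoset H g -> G h.
Proof.
have [_ _ GM _] := Ggrp_is_subgroup R 3.
move=> Gg E; have : lcoset H h h.
  by exists 1%:M; rewrite ?mulmx1//; have [] := Hgrp_is_subgroup v.
by rewrite E => -[k [Gk _] <-]; exact: GM.
Qed.

Lemma orbitP g h : G g -> orbit_of L (lcoset H g) (lcoset H h) <->
  G h /\ exists2 r, L r & r *m (g *m v) = h *m v.
Proof.
have [_ _ GM _] := Ggrp_is_subgroup R 3 => Gg.
split=> [[r Lr]|[Gh [r Lr E]]].
  have [Gr _ _] := L_flag Lr; rewrite -lcosetM => E.
  have Gh : G h by apply: lcoset_Ggrp (esym E); exact: GM.
  split=> //; exists r => //; rewrite mulmxA.
  by apply/(lcoset_HgrpP _ _ Gh) => //; exact: GM.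
have [Gr _ _] := L_flag Lr.
exists r => //; rewrite -lcosetM; apply/lcoset_HgrpP => //; first exact: GM.
by rewrite -mulmxA.
Qed.

(* Off the hyperplane the orbit contains all points on the same side, hence
   points exp (d Z) H tending to H, which lies on the hyperplane. *)
Lemma open_orbit_not_closed g : G g -> bil (g *m v) ep != 0 ->
  ~ quot_closed G H (orbit_of L (lcoset H g)).
Proof.
move=> Gg g0 [_ cl]; set b := bil (g *m v) ep in g0.
(* The factor -b makes B(exp(dZ) v, ep) = d b / 2, which has the sign of b for every d > 0. *)
pose Z := (- b) *: Y.
have Zs : Z \in so R 3 by rewrite memvZ// (frame_Y F).
have Zv d : expm (d *: Z) *m v = v - (d * b) *: em.
  rewrite expm_nilp3 -!scalemxAl ?scalerA (frame_Yv F); last first.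
    by rewrite -!scalemxAr (frame_Yem F) ?mulmx0 !scaler0.
  by rewrite -scalemxAr (frame_Yem F) !scaler0 addr0 mulrN scaleNr.
have : closure ([set h | orbit_of L (lcoset H g) (lcoset H h)]
          : set (subspace G)) 1%:M.
  move=> B; case: (@nbhs_subspaceP _ G (1%:M : subspace G)) => [_ B1|]; last first.
    by case; exact: Ggrp1.
  have : \forall d \near 0^'+, B (expm (d *: Z)).
    have : \forall d \near (0 : R), G (expm (d *: Z)) -> B (expm (d *: Z)).
      have /= := @continuous_expm R 3 Z 0.
      by rewrite /continuous_at scale0r expm0 => /(_ _ B1).
    move=> B0; apply: cvg_within; apply: filterS B0 => d; apply.
    by apply: expm_Ggrp; rewrite memvZ.
  move=> Bd; have [|d [d0 Bd']] := @filter_ex _ (0^'+ : set_system R) _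
      [set d | 0 < d /\ B (expm (d *: Z))].
    by apply: filterI => //; exact: nbhs_right_gt.
  have Gd : G (expm (d *: Z)) by apply: expm_Ggrp; rewrite memvZ.
  exists (expm (d *: Z)); split=> //=.
  apply/orbitP => //; split=> //.
  apply: L_transitive_open; rewrite ?Ggrp_bil// Zv !bilE bil_vep frame_gram -/b.
  have -> : b * (0 - (d * b * - 2^-1)) = 2^-1 * d * b ^+ 2 by field.
  apply: mulr_gt0; last by rewrite exprn_even_gt0.
  by rewrite mulr_gt0.
(* Closedness would put the base point in the orbit; but B(v, ep) = 0, while B(., ep) keeps its
   nonzero sign along the orbit. *)
move=> /cl /orbitP[//|_ [r /L_flag/(flag_bil_ep (g *m v))[c c0 E] rE]].
move: E; rewrite rE mul1mx bil_vep => /esym/eqP.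
by rewrite mulf_eq0 gt_eqF//= => /eqP; apply/eqP.
Qed.

(** The orbit is exactly the set where B(., ep) = 0 and B(., fm) does not have the sign opposite to
    its value at g v: the flag invariants give one inclusion, transitivity the other. Both
    conditions are closed. *)
Lemma wall_orbit_closed g : G g -> bil (g *m v) ep = 0 ->
  quot_closed G H (orbit_of L (lcoset H g)).
Proof.
have [_ _ GM _] := Ggrp_is_subgroup R 3 => Gg g0; split.
  move=> _ [r Lr <-]; rewrite -lcosetM; exists (r *m g) => //.
  by apply: GM => //; have [] := L_flag Lr.
have -> : [set h | orbit_of L (lcoset H g) (lcoset H h)] = G `&`
    ((fun h => bil (h *m v) ep) @^-1` [set 0] `&`
    (fun h => bil (g *m v) fm * bil (h *m v) fm) @^-1` [set x | 0 <= x]).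
  apply/seteqP; split=> h.
    move=> /orbitP[//|Gh [r Lr E]]; split=> //; split.
      have [c c0] := flag_bil_ep (g *m v) (L_flag Lr).
      by rewrite /= -E g0 mulr0.
    have [c c0] := flag_bil_fm (L_flag Lr) g0.
    rewrite /= -E => ->; rewrite mulrCA -expr2.
    by rewrite mulr_ge0 ?sqr_ge0// ltW.
  move=> [Gh [/= h0 gh]]; apply/orbitP => //; split=> //.
  by apply: L_transitive_wall; rewrite ?Ggrp_bil.
apply: closedI; first exact: closed_subspaceT.
apply: closed_subspaceW; apply: closedI.
  apply: closed_comp; last exact: closed_eq.
  by move=> h _; exact: continuous_bil.
apply: closed_comp; last exact: closed_ge.
move=> h _; exact: (continuous_comp (@continuous_bil fm h) (@mulrl_continuous _ _ _)).
Qed.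

Lemma closed_orbitsP g : G g ->
  closed_orbits G H L (lcoset H g) <-> bil (g *m v) ep = 0.
Proof.
move=> Gg; split=> [[_ [[g0 Gg0 <-] cl /orbitP[//|_ [r Lr E]]]]|g0].
  (* The closed orbit is given through another base point [g0]; the nonvanishing of B(., ep) passes
     from g v back to it. *)
  apply/eqP; apply: contraPT cl => b0; apply: open_orbit_not_closed => //.
  have [c c0] := flag_bil_ep (g0 *m v) (L_flag Lr).
  by rewrite E => e; apply: contraNneq b0; rewrite e => ->; rewrite mulr0.
exists (lcoset H g); split; [by exists g|exact: wall_orbit_closed|].
by apply/orbitP => //; split=> //; exists 1%:M; [exact: L1|rewrite mul1mx].
Qed.

End ClosedOrbits.

(** * The structure of so(2,2) and of the singularity *)

Section Structure.
Variables (R : realType) (v : 'cV[R]_4) (sigma theta : 'End('M[R]_4)).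
Variables (a : {vspace 'M[R]_4}) (J1 J2 Xpp : 'M[R]_4).
Hypothesis data : ads3_data v sigma theta a J1 J2 Xpp.
Local Notation so := (so R 3).

Let x := 2^-1 *: Xpp.
Let y := - (2^-1 *: theta Xpp).
Let x' := sigma x.
Let y' := sigma y.
Let s := J2 *m v.
Let ep := x *m v.
Let em := y *m v.

(** * The involutions, the root vectors and their brackets *)

Lemma J1_in_a : J1 \in a.
Proof. by apply: (basis_mem (a_basis data)); rewrite !inE eqxx. Qed.

Lemma J2_in_a : J2 \in a.
Proof. by apply: (basis_mem (a_basis data)); rewrite !inE eqxx orbT. Qed.

Lemma a_combination X : X \in a -> exists c d, X = c *: J1 + d *: J2.
Proof.
rewrite -(span_basis (a_basis data)) => /(@coord_span _ _ _ [tuple J1; J2]) ->.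
rewrite big_ord_recl big_ord_recl big_ord0 addr0 /=.
by eexists; eexists.
Qed.

Lemma J12_free c d : c *: J1 + d *: J2 = 0 -> c = 0 /\ d = 0.
Proof.
move=> cd.
have /freeP/(_ (fun i => [:: c; d]`_i)) := basis_free (a_basis data).
rewrite big_ord_recl big_ord_recl big_ord0 addr0 /= => /(_ cd) h.
by split; [exact: (h ord0)|exact: (h (lift ord0 ord0))].
Qed.

Lemma theta_a X : X \in a -> X \in so /\ theta X = - X.
Proof.
have [ap _ _] := a_maximal data; move=> /(subvP ap).
by move=> /eigen_inP[-> ->]; rewrite scaleN1r.
Qed.

Lemma J1_so : J1 \in so. Proof. by have [] := theta_a J1_in_a. Qed.
Lemma J2_so : J2 \in so. Proof. by have [] := theta_a J2_in_a. Qed.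

Lemma lie_J12 : lie J1 J2 = 0.
Proof.
by have [_ + _] := a_maximal data; apply; [exact: J1_in_a|exact: J2_in_a].
Qed.

Lemma sigma_J1 : sigma J1 = J1.
Proof. by have /eigen_inP[_ ->] := J1_h data; rewrite scale1r. Qed.

Lemma sigma_J2 : sigma J2 = - J2.
Proof. by have /eigen_inP[_ ->] := J2_q data; rewrite scaleN1r. Qed.

Lemma sigma_so X : X \in so -> sigma X \in so.
Proof. by have [+ _ _] := sigma_invol data; exact. Qed.

Lemma theta_so X : X \in so -> theta X \in so.
Proof. by have [[+ _ _] _] := theta_cartan data; exact. Qed.

Lemma sigmaK X : X \in so -> sigma (sigma X) = X.
Proof. by have [_ _ +] := sigma_invol data; exact. Qed.

Lemma sigma_lie X Y : X \in so -> Y \in so -> sigma (lie X Y) = lie (sigma X) (sigma Y).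
Proof. by have [_ + _] := sigma_invol data; exact. Qed.

Lemma theta_lie X Y : X \in so -> Y \in so -> theta (lie X Y) = lie (theta X) (theta Y).
Proof. by have [[_ + _] _] := theta_cartan data; exact. Qed.

(** The fixed algebra of [sigma] is the Lie algebra of the stabilizer of [v], that is, the
    annihilator of [v]; this links the involution to the action on vectors. *)
Lemma sigma_fixedP X : X \in so -> sigma X = X <-> X *m v = 0.
Proof.
move=> Xs; rewrite -(lie_algebra_HgrpP v Xs).
rewrite -(sigma_fixed data) /=; split=> [E|/eigen_inP[_ ->]]; last by rewrite scale1r.
by apply/eigen_inP; rewrite Xs scale1r.
Qed.

Lemma no_root alpha beta X : ~ ((alpha = 1 \/ alpha = -1) /\ (beta = 1 \/ beta = -1)) ->
  (alpha, beta) <> (0, 0) ->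
  X \in root_space so J1 J2 alpha beta -> X = 0.
Proof.
have [rr _] := roots data alpha beta; move=> nr n0 Xr.
have [E|E] := pselect (root_space so J1 J2 alpha beta = 0%VS).
  by apply/eqP; rewrite -memv0 -E.
by case: nr; apply: rr.
Qed.

Lemma x_so : x \in so.
Proof.
by have /root_spaceP[Xs _ _] := Xpp_root data; rewrite memvZ.
Qed.
Lemma y_so : y \in so.
Proof.
have /root_spaceP[Xs _ _] := Xpp_root data.
by rewrite memvN memvZ// theta_so.
Qed.
Lemma x'_so : x' \in so. Proof. exact/sigma_so/x_so. Qed.
Lemma y'_so : y' \in so. Proof. exact/sigma_so/y_so. Qed.

Lemma theta_root alpha beta X : X \in root_space so J1 J2 alpha beta ->
  theta X \in root_space so J1 J2 (- alpha) (- beta).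
Proof.
move=> /root_spaceP[Xs E1 E2]; apply/root_spaceP; split; first exact: theta_so.
  rewrite -[J1 in LHS]opprK -(theta_a J1_in_a).2 lieNl -theta_lie ?J1_so// E1.
  by rewrite linearZ scaleNr.
rewrite -[J2 in LHS]opprK -(theta_a J2_in_a).2 lieNl -theta_lie ?J2_so// E2.
by rewrite linearZ scaleNr.
Qed.

Lemma sigma_root alpha beta X : X \in root_space so J1 J2 alpha beta ->
  sigma X \in root_space so J1 J2 alpha (- beta).
Proof.
move=> /root_spaceP[Xs E1 E2]; apply/root_spaceP; split; first exact: sigma_so.
  by rewrite -[J1 in LHS]sigma_J1 -sigma_lie ?J1_so// E1 linearZ.
rewrite -[J2 in LHS]opprK -sigma_J2 lieNl -sigma_lie ?J2_so// E2.
by rewrite linearZ scaleNr.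
Qed.

Lemma x_root : x \in root_space so J1 J2 1 1.
Proof. exact/memvZ/(Xpp_root data). Qed.
Lemma y_root : y \in root_space so J1 J2 (-1) (-1).
Proof.
by rewrite memvN memvZ//; exact/theta_root/(Xpp_root data).
Qed.
Lemma x'_root : x' \in root_space so J1 J2 1 (-1).
Proof. exact/sigma_root/x_root. Qed.
Lemma y'_root : y' \in root_space so J1 J2 (-1) 1.
Proof. by rewrite -[X in root_space _ _ _ _ X]opprK; exact/sigma_root/y_root. Qed.

Lemma lie_root alpha beta alpha' beta' X Y :
  X \in root_space so J1 J2 alpha beta -> Y \in root_space so J1 J2 alpha' beta' ->
  lie X Y \in root_space so J1 J2 (alpha + alpha') (beta + beta').
Proof.
move=> /root_spaceP[Xs X1 X2] /root_spaceP[Ys Y1 Y2]; apply/root_spaceP.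
split; first exact: lie_so.
  by rewrite lie_jacobi X1 Y1 lieZl lieZr scalerDl.
by rewrite lie_jacobi X2 Y2 lieZl lieZr scalerDl.
Qed.

Lemma lie_xy : lie x y = J1 + J2.
Proof.
rewrite lieNr lieZl lieZr lieC (Xpp_norm data) !scalerA -scalerN opprK scalerA.
by rewrite (_ : _ * _ = 1) ?scale1r//; field.
Qed.

Lemma lie_x'y' : lie x' y' = J1 - J2.
Proof.
by rewrite -sigma_lie ?x_so ?y_so// lie_xy linearD/= sigma_J1 sigma_J2.
Qed.

(** The bracket has weight (0,2), which is not a root. *)
Lemma lie_xy' : lie x y' = 0.
Proof.
apply: (no_root _ _ (lie_root x_root y'_root)); last by case; lra.
by case=> -[]; lra.
Qed.

Lemma lie_yx' : lie y x' = 0.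
Proof.
apply: (no_root _ _ (lie_root y_root x'_root)); last by case; lra.
by case=> -[]; lra.
Qed.

Lemma x_neq0 : x <> 0.
Proof.
move=> x0; have := lie_xy; rewrite x0 /lie mul0mx mulmx0 subrr => /esym.
by rewrite -[J1]scale1r -[J2]scale1r => /J12_free[/eqP]; rewrite oner_eq0.
Qed.

Lemma y_neq0 : y <> 0.
Proof.
move=> y0; have := lie_xy; rewrite y0 /lie mul0mx mulmx0 subrr => /esym.
by rewrite -[J1]scale1r -[J2]scale1r => /J12_free[/eqP]; rewrite oner_eq0.
Qed.

Lemma J2_neq0 : J2 <> 0.
Proof.
move=> J20; have : 0 *: J1 + 1 *: J2 = 0 by rewrite J20 scaler0 scale0r addr0.
by move=> /J12_free[_ /eqP]; rewrite oner_eq0.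
Qed.

Lemma eq_opp0 (p : nat) (z : 'M[R]_(4, p)) : z = - z -> z = 0.
Proof.
move=> /matrixP zz; apply/matrixP => i j; have := zz i j; rewrite !mxE; lra.
Qed.

(* A weight vector whose J2-weight is nonzero is not fixed by sigma. *)
Lemma root_mul_neq0 alpha beta X : beta != 0 -> X <> 0 ->
  X \in root_space so J1 J2 alpha beta -> X *m v <> 0.
Proof.
move=> b0 X0 Xr; have /root_spaceP[Xs _ X2] := Xr.
move=> /(sigma_fixedP Xs) sX; have /root_spaceP[_ _] := sigma_root Xr.
rewrite sX X2 scaleNr => /eq_opp0/eqP; rewrite scaler_eq0 (negPf b0).
by move=> /eqP.
Qed.

Lemma ep_neq0 : ep <> 0.
Proof. exact: root_mul_neq0 (oner_neq0 _) x_neq0 x_root. Qed.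

Lemma em_neq0 : em <> 0.
Proof.
by apply: root_mul_neq0 y_neq0 y_root; rewrite oppr_eq0 oner_eq0.
Qed.

Lemma s_neq0 : s <> 0.
Proof.
move=> /(sigma_fixedP J2_so); rewrite sigma_J2 => /esym/eq_opp0.
exact: J2_neq0.
Qed.

Lemma bil_vv : bil v v = 1. Proof. exact: v_norm data. Qed.

Lemma bil_so0 X u : X \in so -> bil (X *m u) u = 0.
Proof. by move=> Xs; have := bil_so u u Xs; rewrite [X in - X]bilC; lra. Qed.

Lemma J1v : J1 *m v = 0.
Proof. by apply/(sigma_fixedP J1_so)/sigma_J1. Qed.

Lemma x'v : x' *m v = - ep.
Proof.
have /sigma_fixedP[/(_ _)] : x + x' \in so by rewrite memvD ?x_so ?x'_so.
rewrite linearD /= /x' sigmaK ?x_so// addrC => /(_ erefl) E _.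
by move: E; rewrite mulmxDl addrC => /eqP; rewrite addr_eq0 => /eqP.
Qed.

Lemma y'v : y' *m v = - em.
Proof.
have /sigma_fixedP[/(_ _)] : y + y' \in so by rewrite memvD ?y_so ?y'_so.
rewrite linearD /= /y' sigmaK ?y_so// addrC => /(_ erefl) E _.
by move: E; rewrite mulmxDl addrC => /eqP; rewrite addr_eq0 => /eqP.
Qed.

Lemma root_J1 alpha beta X (u : 'cV[R]_4) : X \in root_space so J1 J2 alpha beta ->
  J1 *m (X *m u) = X *m (J1 *m u) + alpha *: (X *m u).
Proof. by move=> /root_spaceP[_ /lie_mulmx -> _]; rewrite scalemxAl. Qed.

Lemma root_J2 alpha beta X (u : 'cV[R]_4) : X \in root_space so J1 J2 alpha beta ->
  J2 *m (X *m u) = X *m (J2 *m u) + beta *: (X *m u).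
Proof. by move=> /root_spaceP[_ _ /lie_mulmx ->]; rewrite scalemxAl. Qed.

(** * The weight basis [v], [s], [ep], [em] and the action on it *)

Lemma J1ep : J1 *m ep = ep.
Proof. by rewrite (root_J1 _ x_root) J1v mulmx0 add0r scale1r. Qed.

Lemma J1em : J1 *m em = - em.
Proof. by rewrite (root_J1 _ y_root) J1v mulmx0 add0r scaleN1r. Qed.

Lemma J1s : J1 *m s = 0.
Proof. by rewrite (lie_mulmx _ lie_J12) J1v mulmx0 mul0mx addr0. Qed.

(** Applying [J1] once and twice isolates [ep] and [em], of eigenvalues 1 and -1, from [v] and [s],
    which it kills; pairing with [v] then separates [v] from [s]. *)
Lemma combination_free c1 c2 c3 c4 :
  c1 *: v + c2 *: s + c3 *: ep + c4 *: em = 0 ->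
  [/\ c1 = 0, c2 = 0, c3 = 0 & c4 = 0].
Proof.
move=> E.
have E1 : c3 *: ep - c4 *: em = 0.
  move: (congr1 (mulmx J1) E); rewrite mulmx0 !mulmxDr -!scalemxAr.
  by rewrite J1v J1s J1ep J1em !scaler0 !add0r scalerN.
have E2 : c3 *: ep + c4 *: em = 0.
  move: (congr1 (mulmx J1) E1); rewrite mulmx0 mulmxBr -!scalemxAr.
  by rewrite J1ep J1em scalerN opprK.
have c30 : c3 = 0.
  have : c3 *: ep = 0.
    apply: eq_opp0; move: E1 E2 => /eqP; rewrite subr_eq0 => /eqP -> /eqP.
    by rewrite addr_eq0 => /eqP.
  by move=> /eqP; rewrite scaler_eq0 => /orP[/eqP//|/eqP/ep_neq0].
have c40 : c4 = 0.
  move: E2; rewrite c30 scale0r add0r => /eqP; rewrite scaler_eq0.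
  by move=> /orP[/eqP//|/eqP/em_neq0].
move: E; rewrite c30 c40 !scale0r !addr0 => E.
have c10 : c1 = 0.
  have := congr1 (bil v) E; rewrite !bilE bil_vv bilC bil_so0 ?J2_so//; lra.
split=> //; move: E; rewrite c10 scale0r add0r => /eqP; rewrite scaler_eq0.
by move=> /orP[/eqP//|/eqP/s_neq0].
Qed.

Lemma combination_span w : exists c1 c2 c3 c4,
  w = c1 *: v + c2 *: s + c3 *: ep + c4 *: em.
Proof.
pose u := fun i : 'I_4 => [:: v; s; ep; em]`_i.
have [|c ->] := @free_span _ _ u _ w.
  move=> c; rewrite !big_ord_recl big_ord0 /u/= addr0 !addrA.
  move=> /combination_free[c1 c2 c3 c4] -[[|[|[|[|//]]]] i4].
  - by rewrite -[RHS]c1; congr c; apply/val_inj.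
  - by rewrite -[RHS]c2; congr c; apply/val_inj.
  - by rewrite -[RHS]c3; congr c; apply/val_inj.
  - by rewrite -[RHS]c4; congr c; apply/val_inj.
rewrite !big_ord_recl big_ord0 /u/= addr0 !addrA.
by do 4 eexists.
Qed.

(** With the basis known, a vector is located by its [J1] eigenvalue. This reduces each unknown
    product to one or two unknown scalars. *)
Lemma J1_eigen0 w : J1 *m w = 0 -> exists c1 c2, w = c1 *: v + c2 *: s.
Proof.
have [c1 [c2 [c3 [c4 ->]]]] := combination_span w.
rewrite !mulmxDr -!scalemxAr J1v J1s J1ep J1em !scaler0 !add0r => E.
have [|_ _ -> c40] := @combination_free 0 0 c3 (- c4).
  by rewrite !scale0r !add0r scaleNr -scalerN.
have -> : c4 = 0 by lra.
by exists c1, c2; rewrite !scale0r !addr0.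
Qed.

Lemma J1_eigen1 w : J1 *m w = w -> exists c, w = c *: ep.
Proof.
have [c1 [c2 [c3 [c4 ->]]]] := combination_span w.
rewrite !mulmxDr -!scalemxAr J1v J1s J1ep J1em !scaler0 !add0r => E.
have [|-> -> _ c40] := @combination_free c1 c2 0 (2 * c4).
  move/eqP: E; rewrite -subr_eq0 => /eqP/(congr1 -%R); rewrite oppr0 => <-.
  by apply/matrixP => i j; rewrite !mxE; ring.
have -> : c4 = 0 by lra.
by exists c3; rewrite !scale0r !add0r addr0.
Qed.

Lemma J1_eigenN1 w : J1 *m w = - w -> exists c, w = c *: em.
Proof.
have [c1 [c2 [c3 [c4 ->]]]] := combination_span w.
rewrite !mulmxDr -!scalemxAr J1v J1s J1ep J1em !scaler0 !add0r => E.
have [|-> -> c30 _] := @combination_free c1 c2 (2 * c3) 0.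
  move/eqP: E; rewrite -subr_eq0 => /eqP <-.
  by apply/matrixP => i j; rewrite !mxE; ring.
have -> : c3 = 0 by lra.
by exists c4; rewrite !scale0r !add0r.
Qed.

(** 2 and -2 are not eigenvalues of [J1], so raising [ep] or lowering [em] gives 0. *)
Lemma J1_eigen2 c (w : 'cV[R]_4) : c = 2 \/ c = -2 -> J1 *m w = c *: w -> w = 0.
Proof.
have [c1 [c2 [c3 [c4 ->]]]] := combination_span w.
rewrite !mulmxDr -!scalemxAr J1v J1s J1ep J1em !scaler0 !add0r => c2E E.
have [|e1 e2 e3 e4] :=
    @combination_free (c * c1) (c * c2) ((c - 1) * c3) ((c + 1) * c4).
  move/eqP: E; rewrite -subr_eq0 => /eqP/(congr1 -%R); rewrite oppr0 => <-.
  by apply/matrixP => i j; rewrite !mxE; ring.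
have -> : c1 = 0 by case: c2E e1 => ->; lra.
have -> : c2 = 0 by case: c2E e2 => ->; lra.
have -> : c3 = 0 by case: c2E e3 => ->; lra.
have -> : c4 = 0 by case: c2E e4 => ->; lra.
by rewrite !scale0r !addr0.
Qed.

Lemma span2_inj c1 c2 c3 c4 : c1 *: v + c2 *: s = c3 *: v + c4 *: s ->
  c1 = c3 /\ c2 = c4.
Proof.
move=> E; have [|e1 e2 _ _] := @combination_free (c1 - c3) (c2 - c4) 0 0.
  rewrite !scale0r !addr0; move/eqP: E; rewrite -subr_eq0 => /eqP <-.
  by apply/matrixP => i j; rewrite !mxE; ring.
by split; lra.
Qed.

Lemma root_J1_kill alpha beta X (w : 'cV[R]_4) c : X \in root_space so J1 J2 alpha beta ->
  J1 *m w = c *: w -> c + alpha = 2 \/ c + alpha = -2 -> X *m w = 0.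
Proof.
move=> Xr Jw /J1_eigen2; apply.
by rewrite (root_J1 _ Xr) Jw -scalemxAr -scalerDl.
Qed.

Lemma raise_kills_ep beta X : X \in root_space so J1 J2 1 beta -> X *m ep = 0.
Proof.
move=> Xr; apply: (@root_J1_kill _ _ _ _ 1 Xr); first by rewrite J1ep scale1r.
by left; ring.
Qed.

Lemma lower_kills_em beta X : X \in root_space so J1 J2 (-1) beta -> X *m em = 0.
Proof.
move=> Xr; apply: (@root_J1_kill _ _ _ _ (-1) Xr); first by rewrite J1em scaleN1r.
by right; ring.
Qed.

(** [J1] is skew for B, so (c + d) B(u, w) = 0. *)
Lemma bil_weight0 (u w : 'cV[R]_4) c d : J1 *m u = c *: u -> J1 *m w = d *: w ->
  c + d != 0 -> bil u w = 0.
Proof.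
move=> Ju Jw cd0; have := bil_so u w J1_so; rewrite Ju Jw bilZl bilZr => E.
apply/eqP; have : (c + d) * bil u w = 0 by rewrite mulrDl E addNr.
by move=> /eqP; rewrite mulf_eq0 (negPf cd0).
Qed.

Lemma bil_epep : bil ep ep = 0.
Proof. by apply: (@bil_weight0 _ _ 1 1); rewrite ?scale1r ?J1ep//; lra. Qed.
Lemma bil_emem : bil em em = 0.
Proof. by apply: (@bil_weight0 _ _ (-1) (-1)); rewrite ?scaleN1r ?J1em//; lra. Qed.
Lemma bil_epv : bil ep v = 0. Proof. exact/bil_so0/x_so. Qed.
Lemma bil_emv : bil em v = 0. Proof. exact/bil_so0/y_so. Qed.
Lemma bil_sv : bil s v = 0. Proof. exact/bil_so0/J2_so. Qed.
Lemma bil_eps : bil ep s = 0.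
Proof.
by apply: (@bil_weight0 _ _ 1 0); rewrite ?scale1r ?scale0r ?J1ep ?J1s//; lra.
Qed.
Lemma bil_ems : bil em s = 0.
Proof.
by apply: (@bil_weight0 _ _ (-1) 0); rewrite ?scaleN1r ?scale0r ?J1em ?J1s//; lra.
Qed.

(** Otherwise [ep] would be orthogonal to the whole basis, against nondegeneracy. *)
Lemma bil_epem_neq0 : bil ep em <> 0.
Proof.
move=> b0; apply: ep_neq0; apply: bil_nondeg => w.
have [c1 [c2 [c3 [c4 ->]]]] := combination_span w.
by rewrite !bilE bil_epv bil_eps bil_epep b0; ring.
Qed.

Lemma bil_ss_neq0 : bil s s <> 0.
Proof.
move=> b0; apply: s_neq0; apply: bil_nondeg => w.
have [c1 [c2 [c3 [c4 ->]]]] := combination_span w.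
by rewrite !bilE bil_sv [bil s ep]bilC [bil s em]bilC bil_eps bil_ems b0; ring.
Qed.

Lemma x_ep : x *m ep = 0. Proof. exact: raise_kills_ep x_root. Qed.
Lemma x'_ep : x' *m ep = 0. Proof. exact: raise_kills_ep x'_root. Qed.
Lemma y_em : y *m em = 0. Proof. exact: lower_kills_em y_root. Qed.
Lemma y'_em : y' *m em = 0. Proof. exact: lower_kills_em y'_root. Qed.

(* With J2 ep = c ep, J2 em = -c em, J2 s = alpha v and x em = p v + r s, the
   two commuting triples (x, y, J1 + J2) and (x', y', J1 - J2) give
   p = (1-c) r = (1+c) (1-r), r alpha = (1-c) p and (1-r) alpha = (1+c) p,
   while p = - bil ep em is nonzero: hence c = 0, alpha = 1, p = r = 1/2. *)
Lemma weights : [/\ J2 *m ep = 0, J2 *m em = 0, J2 *m s = v,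
  x *m em = 2^-1 *: (v + s) & bil ep em = - 2^-1].
Proof.
have [c Jep] : exists c, J2 *m ep = c *: ep.
  by apply: J1_eigen1; rewrite (lie_mulmx _ lie_J12) J1ep mul0mx addr0.
have [c' Jem] : exists c, J2 *m em = c *: em.
  by apply: J1_eigenN1; rewrite (lie_mulmx _ lie_J12) J1em mul0mx addr0 mulmxN.
(* [J2] is skew for B and B(ep, em) is nonzero. *)
have c'E : c' = - c.
  have := bil_so ep em J2_so; rewrite Jep Jem bilZl bilZr => E.
  have : (c' + c) * bil ep em = 0 by lra.
  by move=> /eqP; rewrite mulf_eq0 => /orP[/eqP|/eqP/bil_epem_neq0//]; lra.
rewrite {}c'E {c'} in Jem.
have [al [be Js]] : exists c1 c2, J2 *m s = c1 *: v + c2 *: s.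
  by apply: J1_eigen0; rewrite (lie_mulmx _ lie_J12) J1s mul0mx mulmx0 addr0.
have be0 : be = 0.
  have := bil_so0 s J2_so; rewrite Js !bilE [bil v s]bilC bil_sv mulr0 add0r.
  by move=> /eqP; rewrite mulf_eq0 => /orP[/eqP//|/eqP/bil_ss_neq0].
rewrite {}be0 {be} scale0r addr0 in Js.
have [p [r xem]] : exists c1 c2, x *m em = c1 *: v + c2 *: s.
  by apply: J1_eigen0; rewrite (root_J1 _ x_root) J1em mulmxN scale1r addNr.
have pE : p = - bil ep em.
  rewrite bilC -(bil_so em v x_so) xem !bilE bil_vv bil_sv; ring.
have p0 : p <> 0 by move=> p0; apply: bil_epem_neq0; lra.
(* Evaluated on [v], [x, y'] = 0 gives y' ep = - x em, and [x', y'] = J1 - J2 gives x' em = y' ep +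
   s. *)
have x'em : x' *m em = (- p) *: v + (1 - r) *: s.
  have := lie_mulmx v lie_x'y'; have := lie_mulmx v lie_xy'.
  rewrite y'v x'v mul0mx addr0 !mulmxN -/ep -/em => <- /(congr1 -%R).
  rewrite opprK => ->; rewrite xem mulmxBl J1v -/s.
  by apply/matrixP => i j; rewrite !mxE; ring.
have := root_J2 em x_root; rewrite Jem -scalemxAr -scalerDl xem.
rewrite mulmxDr -!scalemxAr Js -/s addrC scalerDr !scalerA.
move=> /span2_inj[e1 e2].
have := root_J2 em x'_root; rewrite Jem -scalemxAr -scalerDl x'em.
rewrite mulmxDr -!scalemxAr Js -/s addrC scalerDr !scalerA.
move=> /span2_inj[e3 e4].
(* Eliminating p gives alpha = (1 - c)^2 and alpha = (1 + c)^2, since p nonzero forces r and 1 - r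
   to be nonzero; hence c = 0. *)
have al1 : al = (1 - c) ^+ 2.
  have r0 : r <> 0 by move=> r0; apply: p0; rewrite e2 r0; ring.
  have : r * (al - (1 - c) ^+ 2) = 0 by rewrite mulrBr e1 e2; ring.
  by move=> /eqP; rewrite mulf_eq0 => /orP[/eqP/r0//|/eqP]; lra.
have al2 : al = (1 + c) ^+ 2.
  have r0 : 1 - r <> 0.
    by move=> r0; apply: p0; move: e4; rewrite r0 mulr0; lra.
  have pE2 : p = (1 + c) * (1 - r) by lra.
  have : (1 - r) * (al - (1 + c) ^+ 2) = 0 by rewrite mulrBr e3 pE2; ring.
  by move=> /eqP; rewrite mulf_eq0 => /orP[/eqP/r0//|/eqP]; lra.
have c0 : c = 0 by lra.
rewrite c0 in e2 e4 Jep Jem al1; have r12 : r = 2^-1 by lra.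
have p12 : p = 2^-1 by lra.
have al_1 : al = 1 by lra.
split.
- by rewrite Jep scale0r.
- by rewrite c0 oppr0 scale0r.
- by rewrite al_1 scale1r.
- by rewrite p12 r12 scalerDr.
- by lra.
Qed.

Lemma J2ep : J2 *m ep = 0. Proof. by have [] := weights. Qed.
Lemma J2em : J2 *m em = 0. Proof. by have [] := weights. Qed.
Lemma J2s : J2 *m s = v. Proof. by have [] := weights. Qed.
Lemma x_em : x *m em = 2^-1 *: (v + s). Proof. by have [] := weights. Qed.
Lemma bil_epem : bil ep em = - 2^-1. Proof. by have [] := weights. Qed.

Lemma bil_ss : bil s s = -1.
Proof. by have := bil_so v s J2_so; rewrite J2s bil_vv. Qed.

Lemma y'_ep : y' *m ep = - (2^-1 *: (v + s)).
Proof.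
have := lie_mulmx v lie_xy'; rewrite y'v mul0mx addr0 mulmxN.
by rewrite -/em -/ep x_em.
Qed.

Lemma y_ep : y *m ep = 2^-1 *: (v - s).
Proof.
have := lie_mulmx v lie_xy; rewrite -/em -/ep x_em mulmxDl J1v add0r -/s => /eqP.
rewrite addrC -subr_eq => /eqP <-.
by apply/matrixP => i j; rewrite !mxE; field.
Qed.

Lemma x'_em : x' *m em = - (2^-1 *: (v - s)).
Proof.
have := lie_mulmx v lie_yx'; rewrite x'v mul0mx addr0 mulmxN.
by rewrite -/em -/ep y_ep.
Qed.

Lemma x_s : x *m s = - ep.
Proof.
have := root_J2 v x_root; rewrite -/ep -/s J2ep scale1r => /esym/eqP.
by rewrite addr_eq0 => /eqP.
Qed.

Lemma x'_s : x' *m s = - ep.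
Proof.
have := root_J2 v x'_root; rewrite x'v -/s mulmxN J2ep oppr0 scaleN1r opprK.
by move=> /esym/eqP; rewrite addr_eq0 => /eqP.
Qed.

Lemma y_s : y *m s = em.
Proof.
have := root_J2 v y_root; rewrite -/em -/s J2em scaleN1r => /esym/eqP.
by rewrite subr_eq0 => /eqP.
Qed.

Lemma y'_s : y' *m s = em.
Proof.
have := root_J2 v y'_root; rewrite y'v -/s mulmxN J2em oppr0 scale1r.
by move=> /esym/eqP; rewrite subr_eq0 => /eqP.
Qed.

(** * The two null frames and the singularity of AdS_3 *)

Let fp := 2^-1 *: (v + s).
Let fm := 2^-1 *: (v - s).

Lemma frame_spanning w : exists c1 c2 c3 c4,
  w = c1 *: ep + c2 *: em + c3 *: fp + c4 *: fm.
Proof.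
have [c1 [c2 [c3 [c4 ->]]]] := combination_span w.
exists c3, c4, (c1 + c2), (c1 - c2).
by apply/matrixP => i j; rewrite !mxE; field.
Qed.

Lemma n_algP X : X \in n_alg J1 J2 ->
  exists X1 X2, [/\ X1 \in root_space so J1 J2 1 1,
    X2 \in root_space so J1 J2 1 (-1) & X = X1 + X2].
Proof. by move=> /memv_addP[X1 r1 [X2 r2 ->]]; exists X1, X2. Qed.

Lemma theta_n_algP X : X \in (theta @: n_alg J1 J2)%VS ->
  exists X1 X2, [/\ X1 \in root_space so J1 J2 (-1) (-1),
    X2 \in root_space so J1 J2 (-1) 1 & X = X1 + X2].
Proof.
move=> /memv_imgP[_ /n_algP[X1 [X2 [r1 r2 ->]]] ->].
exists (theta X1), (theta X2); split; last exact: linearD.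
  exact: theta_root r1.
by have := theta_root r2; rewrite opprK.
Qed.

Lemma thetaK X : X \in so -> theta (theta X) = X.
Proof. by have [[_ _ +] _] := theta_cartan data; exact. Qed.

Lemma root_so alpha beta X : X \in root_space so J1 J2 alpha beta -> X \in so.
Proof. by move=> /root_spaceP[]. Qed.

Lemma J1f f : f = fp \/ f = fm -> J1 *m f = 0.
Proof.
by case=> ->; rewrite -scalemxAr mulmxDr ?mulmxN J1v J1s ?oppr0 addr0 scaler0.
Qed.

Lemma raise_f beta X f : X \in root_space so J1 J2 1 beta -> f = fp \/ f = fm ->
  exists c, X *m f = c *: ep.
Proof.
move=> Xr /J1f Jf; apply: J1_eigen1.
by rewrite (root_J1 _ Xr) Jf mulmx0 add0r scale1r.
Qed.

Lemma lower_f beta X f : X \in root_space so J1 J2 (-1) beta -> f = fp \/ f = fm ->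
  exists c, X *m f = c *: em.
Proof.
move=> Xr /J1f Jf; apply: J1_eigenN1.
by rewrite (root_J1 _ Xr) Jf mulmx0 add0r scaleN1r.
Qed.

Lemma J2fp : J2 *m fp = fp.
Proof. by rewrite -scalemxAr mulmxDr J2s -/s addrC. Qed.

Lemma J2fm : J2 *m fm = - fm.
Proof. by rewrite -scalemxAr mulmxBr J2s -/s -scalerN opprB. Qed.

Lemma x_f : (x *m fp = 0) * (x *m fm = ep).
Proof.
split; rewrite -scalemxAr mulmxDr ?mulmxN x_s -/ep.
  by rewrite subrr scaler0.
by apply/matrixP => i j; rewrite !mxE; field.
Qed.

Lemma x'_f : (x' *m fp = - ep) * (x' *m fm = 0).
Proof.
split; rewrite -scalemxAr mulmxDr ?mulmxN x'_s x'v.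
  by apply/matrixP => i j; rewrite !mxE; field.
by rewrite subrr scaler0.
Qed.

Lemma y_f : (y *m fp = em) * (y *m fm = 0).
Proof.
split; rewrite -scalemxAr mulmxDr ?mulmxN y_s -/em.
  by apply/matrixP => i j; rewrite !mxE; field.
by rewrite subrr scaler0.
Qed.

Lemma y'_f : (y' *m fp = 0) * (y' *m fm = - em).
Proof.
split; rewrite -scalemxAr mulmxDr ?mulmxN y'_s y'v.
  by rewrite addNr scaler0.
by apply/matrixP => i j; rewrite !mxE; field.
Qed.

Definition bil_basis := (bil_vv, bil_ss, bil_epep, bil_emem, bil_epem,
  (etrans (bilC em ep) bil_epem), bil_epv, (etrans (bilC v ep) bil_epv),
  bil_emv, (etrans (bilC v em) bil_emv), bil_sv, (etrans (bilC v s) bil_sv),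
  bil_eps, (etrans (bilC s ep) bil_eps), bil_ems, (etrans (bilC s em) bil_ems)).

Lemma null_frame_N : null_frame a (n_alg J1 J2) v ep em fp fm J1 J2 x x' y.
Proof.
split; rewrite ?x_f ?x'_f ?x_em ?x'_em ?J2fp ?J2fm ?J2ep ?J1ep ?J1em ?y_em//.
- by apply/matrixP => i j; rewrite !mxE; field.
- by rewrite !bil_basis.
- by rewrite !bil_basis.
- by rewrite !bil_basis.
- by rewrite !bilE !bil_basis; field.
- by rewrite !bilE !bil_basis; field.
- by rewrite !bilE !bil_basis; field.
- by rewrite !bilE !bil_basis; field.
- by rewrite !bilE !bil_basis; field.
- by rewrite !bilE !bil_basis; field.
- by rewrite !bilE !bil_basis; field.
- exact: frame_spanning.
- move=> X Xa; have [Xs _] := theta_a Xa; have [c [d ->]] := a_combination Xa.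
  split; first by rewrite memvD ?memvZ ?J1_so ?J2_so.
    exists c; rewrite mulmxDl -!scalemxAl J1ep J2ep.
    by rewrite scaler0 addr0.
  exists (- d); rewrite mulmxDl -!scalemxAl J2fm J1f; last by right.
  by rewrite scaler0 add0r scalerN scaleNr.
- move=> X /n_algP[X1 [X2 [r1 r2 ->]]].
  split; first by rewrite memvD ?(root_so r1)// (root_so r2).
    by rewrite mulmxDl (raise_kills_ep r1) (raise_kills_ep r2) addr0.
  have [|c1 E1] := @raise_f _ _ fm r1; first by right.
  have [|c2 E2] := @raise_f _ _ fm r2; first by right.
  by exists (c1 + c2); rewrite mulmxDl E1 E2 scalerDl.
- exact: J1_in_a.
- exact: J2_in_a.
- by rewrite -[x]addr0 memv_add ?x_root ?mem0v.
- by rewrite -[x']add0r memv_add ?x'_root ?mem0v.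
- exact: y_so.
- by apply: J1f; left.
- by apply: J1f; right.
Qed.

(** The mirror image of the frame for [n_alg]: [ep] and [em] are exchanged, [fp] and [fm] are
    exchanged, and [J1], [J2] change sign. *)
Lemma null_frame_Nbar :
  null_frame a (theta @: n_alg J1 J2)%VS v em ep fm fp (- J1) (- J2) y y' x.
Proof.
split; rewrite ?y_f ?y'_f ?y_ep ?y'_ep ?mulNmx ?J2fp ?J2fm ?J2em ?J1ep ?J1em
  ?x_ep ?opprK ?oppr0//.
- by apply/matrixP => i j; rewrite !mxE; field.
- by rewrite !bil_basis.
- by rewrite !bil_basis.
- by rewrite !bil_basis.
- by rewrite !bilE !bil_basis; field.
- by rewrite !bilE !bil_basis; field.
- by rewrite !bilE !bil_basis; field.
- by rewrite !bilE !bil_basis; field.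
- by rewrite !bilE !bil_basis; field.
- by rewrite !bilE !bil_basis; field.
- by rewrite !bilE !bil_basis; field.
- move=> w; have [c1 [c2 [c3 [c4 ->]]]] := frame_spanning w.
  exists c2, c1, c4, c3; rewrite -!addrA addrCA; congr (_ + (_ + _)).
  exact: addrC.
- move=> X Xa; have [Xs _] := theta_a Xa; have [c [d ->]] := a_combination Xa.
  split; first by rewrite memvD ?memvZ ?J1_so ?J2_so.
    exists (- c); rewrite mulmxDl -!scalemxAl J1em J2em.
    by rewrite scaler0 addr0 scalerN scaleNr.
  exists d; rewrite mulmxDl -!scalemxAl J2fp J1f; last by left.
  by rewrite scaler0 add0r.
- move=> X /theta_n_algP[X1 [X2 [r1 r2 ->]]].
  split; first by rewrite memvD ?(root_so r1)// (root_so r2).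
    by rewrite mulmxDl (lower_kills_em r1) (lower_kills_em r2) addr0.
  have [|c1 E1] := @lower_f _ _ fp r1; first by left.
  have [|c2 E2] := @lower_f _ _ fp r2; first by left.
  by exists (c1 + c2); rewrite mulmxDl E1 E2 scalerDl.
- by rewrite memvN J1_in_a.
- by rewrite memvN J2_in_a.
(* [theta] is involutive on so(2,2), so [y] is the image of [theta y], of weight (1,1). *)
- rewrite -[y]thetaK ?y_so// memv_img// -[theta y]addr0 memv_add ?mem0v//.
  by have := theta_root y_root; rewrite !opprK.
- rewrite -[y']thetaK ?y'_so// memv_img// -[theta y']add0r memv_add ?mem0v//.
  by have := theta_root y'_root; rewrite !opprK.
- exact: x_so.
- by rewrite J1f ?oppr0//; right.
- by rewrite J1f ?oppr0//; left.
Qed.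

Lemma S3P g : Ggrp g -> S3 v theta a J1 J2 (lcoset (Hgrp v) g) <->
  bil (g *m v) ep = 0 \/ bil (g *m v) em = 0.
Proof.
move=> Gg; rewrite -(closed_orbitsP null_frame_N Gg).
by rewrite -(closed_orbitsP null_frame_Nbar Gg).
Qed.

(** * The subgroup [G2] and the singularity of AdS_2 *)

Let t := ep - em.
(** The negative direction on which [G2] acts trivially. The vectors [v], [t], [s], [y0] are
    orthogonal, of square norms 1, 1, -1, -1. *)
Let y0 := ep + em.
Local Notation Q0 := (q0 sigma theta Xpp).
Local Notation P1 := (p1 sigma theta J2 Xpp).

Lemma q0E : Q0 = 2^-1 *: (x - x' - y + y').
Proof.
have XE : Xpp = 2 *: x by rewrite scalerA mulfV ?scale1r.
have tXE : theta Xpp = - 2 *: y.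
  by rewrite scalerN scalerA mulNr mulfV// scaleNr scale1r opprK.
have sXE : sigma Xpp = 2 *: x' by rewrite {1}XE linearZ.
have stXE : sigma (theta Xpp) = - 2 *: y' by rewrite tXE linearZ.
rewrite /q0 stXE tXE sXE {1}XE.
by apply/matrixP => i j; rewrite !mxE; field.
Qed.

Lemma q0_so : Q0 \in so.
Proof.
by rewrite q0E memvZ// memvD ?y'_so// memvB ?y_so// memvB ?x_so ?x'_so.
Qed.

Lemma q0_mul (w : 'cV[R]_4) : Q0 *m w = 2^-1 *: (x *m w - x' *m w - y *m w + y' *m w).
Proof. by rewrite q0E -scalemxAl !mulmxDl !mulNmx. Qed.

Lemma q0_v : Q0 *m v = t.
Proof.
rewrite q0_mul x'v y'v -/ep -/em.
by apply/matrixP => i j; rewrite !mxE; field.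
Qed.

Lemma q0_s : Q0 *m s = 0.
Proof.
rewrite q0_mul x_s x'_s y_s y'_s.
by apply/matrixP => i j; rewrite !mxE; field.
Qed.

Lemma q0_t : Q0 *m t = - v.
Proof.
rewrite q0_mul !mulmxBr x_ep x'_ep y_em y'_em x_em x'_em y_ep y'_ep.
by apply/matrixP => i j; rewrite !mxE; field.
Qed.

Lemma q0_y0 : Q0 *m y0 = 0.
Proof.
rewrite q0_mul !mulmxDr x_ep x'_ep y_em y'_em x_em x'_em y_ep y'_ep.
by apply/matrixP => i j; rewrite !mxE; field.
Qed.

Lemma J2_t : J2 *m t = 0. Proof. by rewrite mulmxBr J2ep J2em subrr. Qed.
Lemma J2_y0 : J2 *m y0 = 0. Proof. by rewrite mulmxDr J2ep J2em addr0. Qed.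

Lemma bil_expand u w : bil u w = bil u v * bil w v + bil u t * bil w t
  - bil u s * bil w s - bil u y0 * bil w y0.
Proof.
have [c1 [c2 [c3 [c4 ->]]]] := combination_span u.
have [d1 [d2 [d3 [d4 ->]]]] := combination_span w.
by rewrite !bilE !bil_basis; field.
Qed.

Local Notation G2' := (G2 sigma theta J2 Xpp).
Local Notation H2' := (H2 v sigma theta J2 Xpp).

Lemma so12_subalgebra X : X \in <<[:: Q0; q1 J2; P1]>>%VS -> X \in so /\ X *m y0 = 0.
Proof.
move=> /(@coord_span _ _ _ [tuple Q0; q1 J2; P1]) ->.
rewrite !big_ord_recl big_ord0 addr0 /=; split.
  have P1s : P1 \in so by exact: lie_so q0_so J2_so.
  apply: memvD; first exact/memvZ/q0_so.
  by apply: memvD; apply: memvZ; [exact: J2_so|exact: P1s].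
have P1y : P1 *m y0 = 0.
  by rewrite mulmxBl -!mulmxA q0_y0 [_ *m y0]J2_y0 !mulmx0 subrr.
rewrite mulmxDl -scalemxAl q0_y0 scaler0 add0r mulmxDl.
by rewrite -scalemxAl [_ *m y0]J2_y0 scaler0 add0r -scalemxAl P1y scaler0.
Qed.

Lemma G2_fix : G2' `<=` Hgrp y0.
Proof.
apply: connected_subgroup_sub; first exact: Hgrp_is_subgroup.
by move=> X /so12_subalgebra[Xs Xy]; split; [exact: expm_Ggrp|exact: expm_fix].
Qed.

Lemma G2_is_subgroup : is_subgroup G2'.
Proof.
apply: connected_subgroup_is_subgroup => X /so12_subalgebra[Xs _].
by have [+ _ _ _] := Ggrp_is_subgroup R 3; apply; exact: expm_Ggrp.
Qed.

Lemma H2_1 : H2' 1%:M.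
Proof.
have [_ G21 _ _] := G2_is_subgroup; split=> //.
by have [] := Hgrp_is_subgroup v.
Qed.

Lemma iota2_lcoset g : iota2 v (lcoset H2' g) = lcoset (Hgrp v) g.
Proof.
have [_ _ HM _] := Hgrp_is_subgroup v.
apply/seteqP; split=> [_ [_ [k [_ Hk] <-] [h Hh <-]]|_ [h Hh <-]].
  by exists (k *m h); [exact: HM|rewrite mulmxA].
exists g; last by exists h.
by exists 1%:M; [exact: H2_1|rewrite mulmx1].
Qed.

(** As [g] fixes [y0], which is orthogonal to [v], B(gv, ep) = - B(gv, em). Both halves of the
    singularity thus reduce to the same equation. *)
Lemma S2P g : G2' g -> S2 v sigma theta a J1 J2 Xpp (lcoset H2' g) <->
  bil (g *m v) t = 0.
Proof.
move=> G2g; have [Gg gy] := G2_fix G2g; have [gE _] := Ggrp_SOset Gg.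
rewrite /S2 /= iota2_lcoset S3P//.
have gy0 : bil (g *m v) y0 = 0.
  by rewrite -gy bil_orth// !bilE !bil_basis addr0.
move: gy0; rewrite !bilE => gy0.
split=> [[_ [E|E]]|E]; [lra|lra|split; last by left; lra].
by exists g.
Qed.

(** Treats both light-like directions at once through a sign e; the last equation makes the
    geodesics affine. *)
Lemma lightlikeP E : future_lightlike sigma theta J2 Xpp E ->
  exists e : R, [/\ e ^+ 2 = 1, E \in <<[:: Q0; q1 J2; P1]>>%VS,
    E *m v = t + e *: s & E *m (t + e *: s) = 0].
Proof.
have Q0_span : Q0 \in <<[:: Q0; q1 J2; P1]>>%VS by rewrite memv_span// !inE eqxx.
have q1_span : q1 J2 \in <<[:: Q0; q1 J2; P1]>>%VS.
  by rewrite memv_span// !inE eqxx orbT.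
case=> ->; [exists 1|exists (-1)]; (split; first by rewrite ?expr1n ?sqrrN ?expr1n).
- by rewrite memvD.
- by rewrite mulmxDl q0_v scale1r.
- rewrite mulmxDl ![_ *m (t + _)]mulmxDr -!scalemxAr q0_t q0_s J2_t J2s.
  by rewrite scaler0 addr0 add0r scale1r addNr.
- by rewrite memvB.
- by rewrite mulmxBl q0_v scaleN1r.
- rewrite mulmxBl ![_ *m (t + _)]mulmxDr -!scalemxAr q0_t q0_s J2_t J2s.
  by rewrite scaler0 addr0 add0r scaleN1r opprK addNr.
Qed.

Lemma geodesicE E e (r : R) : E *m v = t + e *: s -> E *m (t + e *: s) = 0 ->
  expm (r *: E) *m v = v + r *: (t + e *: s).
Proof.
move=> Ev EEv.
have Nv : (r *: E) *m v = r *: (t + e *: s) by rewrite -scalemxAl Ev.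
have NNv : (r *: E) *m (r *: (t + e *: s)) = 0.
  by rewrite -scalemxAl -scalemxAr EEv !scaler0.
by rewrite expm_nilp3 Nv NNv ?mulmx0// scaler0 addr0.
Qed.

(* By Lagrange's identity the minor is at least 1 in absolute value. *)
Lemma minor_gt0 g : Ggrp g ->
  0 < bil (g *m v) v * bil (g *m t) t - bil (g *m v) t * bil (g *m t) v.
Proof.
pose f (h : 'M[R]_4) :=
  bil (h *m v) v * bil (h *m t) t - bil (h *m v) t * bil (h *m t) v.
apply: (@continuous_gt0_connected _ _ (@Ggrp R 3) f 1%:M).
- exact: component_connected.
- move=> h; exact: (cvgB
    (cvgM (@continuous_bil _ v v h) (@continuous_bil _ t t h))
    (cvgM (@continuous_bil _ v t h) (@continuous_bil _ t v h))).
- move=> h /Ggrp_SOset[hE _]; apply/eqP; rewrite /f => f0.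
  have := bil_orth v v hE; have := bil_orth t t hE; have := bil_orth v t hE.
  rewrite [LHS]bil_expand => e1; rewrite [LHS]bil_expand => e2.
  rewrite [LHS]bil_expand => e3.
  have E : bil v t = 0 /\ bil t t = 1.
    by rewrite !bilE !bil_basis; split; field.
  move: e1 e2 e3; rewrite E.1 E.2 bil_vv.
  move: f0.
  set a1 := bil _ v; set a2 := bil (h *m v) t; set a3 := bil (h *m v) s.
  set a4 := bil (h *m v) y0; set b1 := bil _ v; set b2 := bil (h *m t) t.
  set b3 := bil (h *m t) s; set b4 := bil (h *m t) y0 => f0 e1 e2 e3.
  (* Lagrange's identity. As the columns are orthonormal for B, the squared minor is 1 + a3^2 + a4^2
     + b3^2 + b4^2 + (a3 b4 - a4 b3)^2, which cannot be 0. *)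
  have l : (a1 * b2 - a2 * b1) ^+ 2
      = (a1 * a1 + a2 * a2) * (b1 * b1 + b2 * b2) - (a1 * b1 + a2 * b2) ^+ 2.
    by ring.
  have := sqr_ge0 a3; have := sqr_ge0 a4; have := sqr_ge0 b3.
  have := sqr_ge0 b4; have := sqr_ge0 (a3 * b4 - a4 * b3).
  move: l; rewrite f0.
  have -> : a1 * a1 + a2 * a2 = 1 + a3 * a3 + a4 * a4 by lra.
  have -> : b1 * b1 + b2 * b2 = 1 + b3 * b3 + b4 * b4 by lra.
  have -> : a1 * b1 + a2 * b2 = a3 * b3 + a4 * b4 by lra.
  by lra.
- exact: Ggrp1.
- by rewrite /f !mul1mx !bilE !bil_basis; lra.
Qed.

(** The slope is b2 + e c2 with b2 = B(gt, t) and c2 = B(gs, t). Below, b2 is shown to have the sign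
    of B(gv, v) and to exceed c2 in absolute value. *)
Lemma future_sign g E e : G2' g -> bil (g *m v) t ^+ 2 < 1 ->
  e ^+ 2 = 1 -> E *m v = t + e *: s ->
  0 < bil (g *m v) v * bil (g *m (E *m v)) t.
Proof.
move=> G2g at1 e1 ->; have [Gg gy] := G2_fix G2g.
have [gE _] := Ggrp_SOset Gg; have m0 := minor_gt0 Gg.
have [gVE _] := Ggrp_SOset (GgrpV Gg); have gu := SOset_unit (Ggrp_SOset Gg).
have byy u : bil u y0 = 0 -> bil (g *m u) y0 = 0.
  by move=> u0; rewrite -gy bil_orth.
have [tt0 vt0] : bil t t = 1 /\ bil v t = 0.
  by rewrite !bilE !bil_basis; split; field.
have [vy ty] : bil v y0 = 0 /\ bil t y0 = 0.
  by rewrite !bilE !bil_basis; split; field.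
(* The numbers B(gu, t) are the coordinates of g^-1 t, which is of square norm 1 and orthogonal to
   [y0]; hence a2^2 + b2^2 - c2^2 = 1. *)
have rowE u : bil (invmx g *m t) u = bil (g *m u) t.
  by rewrite -(bil_orth _ u gE) mulKVmx// bilC.
have := bil_orth t t gVE; rewrite [LHS]bil_expand !rowE gy tt0 [bil y0 t]bilC ty.
move=> row.
have := bil_orth v v gE; have := bil_orth t t gE; have := bil_orth v t gE.
rewrite [LHS]bil_expand => c1; rewrite [LHS]bil_expand => c2.
rewrite [LHS]bil_expand => c3.
move: c1 c2 c3; rewrite tt0 vt0 bil_vv (byy _ vy) (byy _ ty).
have -> : bil (g *m (t + e *: s)) t = bil (g *m t) t + e * bil (g *m s) t.
  by rewrite [g *m (t + _)]mulmxDr -[g *m (e *: s)]scalemxAr bilDl bilZl.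
move: row m0 at1.
set a1 := bil (g *m v) v; set a2 := bil (g *m v) t; set a3 := bil (g *m v) s.
set b1 := bil (g *m t) v; set b2 := bil (g *m t) t; set b3 := bil (g *m t) s.
set c2 := bil (g *m s) t => row m0 at1 k1 k2 k3.
(* If a1 b2 <= 0, the positive minor is at most - a2 b1, so its square is at most a2^2 b1^2. But
   that square equals b1^2 + b2^2 + a3^2 and a2^2 < 1, so b1 = b2 = 0 and the minor vanishes. *)
have ab : 0 < a1 * b2.
  rewrite ltNge; apply/negP => ab.
  have l : (a1 * b2 - a2 * b1) ^+ 2
      = (a1 * a1 + a2 * a2) * (b1 * b1 + b2 * b2) - (a1 * b1 + a2 * b2) ^+ 2.
    by ring.
  have mE : (a1 * b2 - a2 * b1) ^+ 2 = b1 ^+ 2 + b2 ^+ 2 + a3 ^+ 2.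
    rewrite l; have -> : a1 * a1 + a2 * a2 = 1 + a3 * a3 by lra.
    have -> : a1 * b1 + a2 * b2 = a3 * b3 by lra.
    have b3E : b3 * b3 = b1 * b1 + b2 * b2 - 1 by lra.
    have -> : (a3 * b3) ^+ 2 = a3 * a3 * (b3 * b3) by ring.
    by rewrite b3E; ring.
  have mle : (a1 * b2 - a2 * b1) ^+ 2 <= (a2 * b1) ^+ 2.
    have -> : (a2 * b1) ^+ 2 = (- (a2 * b1)) ^+ 2 by rewrite sqrrN.
    by rewrite ler_pXn2r// ?nnegrE; lra.
  have a2b1 : (a2 * b1) ^+ 2 <= b1 ^+ 2.
    by rewrite exprMn ler_piMl ?sqr_ge0// ltW.
  have b20 : b2 ^+ 2 = 0.
    by have := sqr_ge0 b2; have := sqr_ge0 a3; lra.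
  have b10 : b1 ^+ 2 = 0.
    have := sqr_ge0 a3; have := sqr_ge0 b1; rewrite exprMn in mle.
    have [->|b1N] := eqVneq b1 0; first by rewrite expr0n.
    have : 0 < (1 - a2 ^+ 2) * b1 ^+ 2.
      by rewrite mulr_gt0 ?subr_gt0// exprn_even_gt0.
    by lra.
  move: m0; move/eqP: b10; rewrite sqrf_eq0 => /eqP ->.
  by move/eqP: b20; rewrite sqrf_eq0 => /eqP ->; rewrite !mulr0 subr0 ltxx.
have a10 : a1 != 0 by apply: contraTneq ab => ->; rewrite mul0r ltxx.
(* By the row identity b2^2 - c2^2 = 1 - a2^2 > 0, so the term e c2 cannot change the sign of the
   slope. *)
have lt2 : (a1 * (e * c2)) ^+ 2 < (a1 * b2) ^+ 2.
  rewrite !exprMn e1 mul1r ltr_pM2l ?exprn_even_gt0//.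
  by lra.
have : `|a1 * (e * c2)| < a1 * b2.
  rewrite -(gtr0_norm ab) -ltr_sqr ?nnegrE ?normr_ge0//.
  by rewrite !real_normK ?num_real.
by rewrite ltr_norml mulrDr => /andP[]; lra.
Qed.

(** For e = -1 the region consists of trapped points, for e = 1 of escaping ones. The conditions
    involve [g] only through g v, so any representative of the point may be used. *)
Definition AdS2_region (e : R) : set (set 'M[R]_4) :=
  [set X | exists g, [/\ G2' g, lcoset H2' g = X, bil (g *m v) t ^+ 2 < 1 &
    0 < e * (bil (g *m v) t * bil (g *m v) v)]].

Lemma AdS2_region_open e : quot_open G2' H2' (AdS2_region e).
Proof.
have [_ _ GM _] := G2_is_subgroup.
split; first by move=> X [g [Gg <- _ _]]; exists g.
have -> : [set g | AdS2_region e (lcoset H2' g)] = G2' `&`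
    ((fun g => 1 - bil (g *m v) t * bil (g *m v) t) @^-1` [set x | 0 < x] `&`
    (fun g => e * (bil (g *m v) t * bil (g *m v) v)) @^-1` [set x | 0 < x]).
  apply/seteqP; split=> h.
    move=> [g [Gg E g1 g2]].
    have [k [Gk [_ kv]] hE] : lcoset H2' g h.
      by rewrite E; exists 1%:M; [exact: H2_1|rewrite mulmx1].
    split; first by rewrite -hE; exact: GM.
    by rewrite /= -hE -mulmxA kv; split=> //; rewrite subr_gt0 -expr2.
  move=> [Gh [/= h1 h2]]; exists h; split=> //.
  by rewrite expr2 -subr_gt0.
have ct h := @continuous_bil R v t h; have cv h := @continuous_bil R v v h.
apply: openI; first exact: open_subspaceT.
apply: open_subspaceW; apply: openI; apply: open_comp; try exact: open_gt.
  move=> h _; exact: (cvgB (cvg_cst _) (cvgM (ct h) (ct h))).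
by move=> h _; exact: (continuous_comp (cvgM (ct h) (cv h)) (@mulrl_continuous _ _ _)).
Qed.

Lemma AdS2_region_nonempty e : e ^+ 2 = 1 -> AdS2_region e !=set0.
Proof.
move=> e1.
have [|E [_ El Ev EEv]] := @lightlikeP (Q0 + q1 J2); first by left.
(* The point at parameter e/2 on a light-like geodesic from the base point: there B(., t) = e/2 and
   B(., v) = 1. *)
exists (lcoset H2' (expm ((e / 2) *: (Q0 + q1 J2)))).
exists (expm ((e / 2) *: (Q0 + q1 J2))); rewrite (geodesicE _ Ev EEv); split=> //.
- by apply: connected_subgroup_expm; rewrite memvZ.
- rewrite !bilE !bil_basis.
  have -> : forall z : R, z = e / 2 -> z ^+ 2 < 1 by move=> z ->; rewrite exprMn e1; lra.
  by [].
  by field.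
- rewrite !bilE !bil_basis.
  have -> : forall z : R, z = e ^+ 2 / 2 -> 0 < z by move=> z ->; rewrite e1; lra.
  by [].
  by field.
Qed.

Lemma geodesic_S2P g E e r : G2' g -> E \in <<[:: Q0; q1 J2; P1]>>%VS ->
  E *m v = t + e *: s -> E *m (t + e *: s) = 0 ->
  S2 v sigma theta a J1 J2 Xpp (geodesic v sigma theta J2 Xpp g E r) <->
  bil (g *m v) t + r * bil (g *m (E *m v)) t = 0.
Proof.
have [_ _ GM _] := G2_is_subgroup => Gg El Ev EEv.
rewrite S2P; last by apply: GM => //; apply: connected_subgroup_expm; rewrite memvZ.
by rewrite -mulmxA (geodesicE _ Ev EEv) [g *m (v + _)]mulmxDr
  -[g *m (r *: _)]scalemxAr bilDl bilZl Ev.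
Qed.

Lemma region_trapped X : AdS2_region (-1) X ->
  trapped v sigma theta a J1 J2 Xpp X.
Proof.
have [_ _ GM _] := G2_is_subgroup.
move=> [h [Gh hX at1 a0]] g E Gg gX /lightlikeP[e [e1 El Ev EEv]].
have hv : h *m v = g *m v.
  have [k [_ [_ kv]] <-] : lcoset H2' g h.
    by rewrite gX -hX; exists 1%:M; [exact: H2_1|rewrite mulmx1].
  by rewrite -mulmxA kv.
rewrite hv in at1 a0.
have d0 := future_sign Gg at1 e1 Ev.
move: a0 d0; set b := bil (g *m v) t; set c := bil (g *m v) v.
set d := bil (g *m (E *m v)) t => a0 d0.
have dN0 : d != 0 by apply: contraTneq d0 => ->; rewrite mulr0 ltxx.
have cN0 : c != 0 by apply: contraTneq d0 => ->; rewrite mul0r ltxx.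
(* The zero of the affine function b + r d; it is positive because b c < 0 and c d > 0. *)
exists (- b / d); last first.
  by apply/(geodesic_S2P _ Gg El Ev EEv); rewrite -/b -/d divfK// subrr.
have -> : - b / d = (-1 * (b * c)) * (c * d) / (c * d) ^+ 2.
  by field; rewrite cN0 dN0.
by apply: divr_gt0; [exact: mulr_gt0|rewrite exprn_even_gt0//= mulf_neq0].
Qed.

Lemma region_escapes X : AdS2_region 1 X -> escapes v sigma theta a J1 J2 Xpp X.
Proof.
move=> [g [Gg gX at1 a0]].
have El : future_lightlike sigma theta J2 Xpp (Q0 + q1 J2) by left.
exists g, (Q0 + q1 J2); split=> // -[r r0].
have [e [e1 Es Ev EEv]] := lightlikeP El.
move=> /(geodesic_S2P _ Gg Es Ev EEv).
have := future_sign Gg at1 e1 Ev.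
move: a0; set b := bil (g *m v) t; set c := bil (g *m v) v.
set d := bil (g *m ((Q0 + q1 J2) *m v)) t => a0 d0 bd.
(* After multiplication by c, the value b + r d is a sum of two positive terms for r > 0, so it
   never vanishes. *)
have : 0 < r * (c * d) by rewrite mulr_gt0.
have : c * (b + r * d) = 0 by rewrite bd mulr0.
by lra.
Qed.

End Structure.

Theorem mainTheorem7 (R : realType) (v : 'cV[R]_4) (sigma theta : 'End('M[R]_4))
    (a : {vspace 'M[R]_4}) (J1 J2 Xpp : 'M[R]_4)
    (data : ads3_data v sigma theta a J1 J2 Xpp) :
  (exists U : set (set 'M[R]_4),
     [/\ quot_open (G2 sigma theta J2 Xpp) (H2 v sigma theta J2 Xpp) U,
         U !=set0 &
         forall x, U x -> trapped v sigma theta a J1 J2 Xpp x]) /\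
  (exists U : set (set 'M[R]_4),
     [/\ quot_open (G2 sigma theta J2 Xpp) (H2 v sigma theta J2 Xpp) U,
         U !=set0 &
         forall x, U x -> escapes v sigma theta a J1 J2 Xpp x]).
Proof.
split.
  exists (AdS2_region v sigma theta J2 Xpp (-1)); split.
  - exact: (AdS2_region_open data).
  - by apply: (AdS2_region_nonempty data); rewrite ?sqrrN ?expr1n.
  - exact: (region_trapped data).
exists (AdS2_region v sigma theta J2 Xpp 1); split.
- exact: (AdS2_region_open data).
- by apply: (AdS2_region_nonempty data); rewrite ?expr1n.
- exact: (region_escapes data).
Qed.
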